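(* Let $\Psi=(\psi_{jk})_{j,k=1}^d$ be a Haar-distributed unitary $d\times d$ matrix. If $(a_l,b_l)_{l=1}^L$ and $(j_r,k_r,j_r',k_r')_{r=1}^R$ are indices and $\psi_G=\prod_{r=1}^R\psi_{j_rk_r}\overline{\psi_{j_r'k_r'}}$, then as $d\to\infty$ $$ \mathbb E\left[\prod_{l=1}^L\Bigl(|\psi_{a_lb_l}|^2-\frac1d\Bigr)\psi_G\right]=\sum_{(\sigma,\tau)\in\mathcal{CP}(\prod_l|\psi_{a_lb_l}|^2\psi_G)}d^{-2\left\lfloor\frac{\mathfrak a(\sigma,\tau)+1}{2}\right\rfloor}\,\rho_{\mathfrak a(\sigma,\tau)}(\sigma\tau^{-1})\,\mathrm{Wg}(\sigma\tau^{-1},d)\,\bigl(1+O(d^{-1})\bigr). $$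
   Context: Weingarten function: for $d\ge q$, $\mathrm{Wg}(\cdot,d):\mathfrak S_q\to\mathbb R$ is the convolution inverse of $\omega\mapsto d^{\mathscr C(\omega)}$ on the symmetric group $\mathfrak S_q$, where $\mathscr C(\omega)$ is the number of cycles of $\omega$ (fixed points included). It depends only on the cycle structure of $\omega$ (and on $q$). Covering pairs: for a product $\psi_{j_1k_1}\cdots\psi_{j_qk_q}\overline{\psi_{j_1'k_1'}}\cdots\overline{\psi_{j_q'k_q'}}$, the set $\mathcal{CP}$ of covering pairs is the set of $(\sigma,\tau)\in\mathfrak S_q^2$ with $j_l=j'_{\tau(l)}$ and $k_l=k'_{\sigma(l)}$ for all $l=1,\dots,q$. Represent row indices as black vertices, column indices as white vertices, $\psi_{jk}$ as an edge from black $j$ to white $k$, and $\overline{\psi_{j'k'}}$ as an edge from white $k'$ to black $j'$. Covering pairs then correspond to partitions of the edges into directed circuits, each $n$-cycle of $\sigma\tau^{-1}$ corresponding to a circuit with $2n$ edges ($\overline{\psi_{j'_rk'_r}}$ follows $\psi_{j_lk_l}$ when $\sigma(l)=r$, and $\psi_{j_mk_m}$ follows $\overline{\psi_{j_r'k_r'}}$ when $\tau(m)=r$). Atoms: the centered factors $|\psi_{a_lb_l}|^2-\frac1d$ are called atoms. For $(\sigma,\tau)\in\mathcal{CP}(\prod_l|\psi_{a_lb_l}|^2\psi_G)$ (here $q=L+R$), $\mathfrak A(\sigma,\tau)$ is the set of those $2$-circuits of the covering that correspond to atoms, i.e. consisting of the two edges $\psi_{a_lb_l},\overline{\psi_{a_lb_l}}$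 of one atom $l$; and $\mathfrak a(\sigma,\tau)=|\mathfrak A(\sigma,\tau)|$. The functions $\rho_K$ are defined on permutations with at least $K$ fixed points, written ${\circ}^K\omega$ (the permutation $\omega$ extended by $K$ fixed points): $$\rho_{2k}({\circ}^{2k}\omega)=(2k-1)!!,\qquad \rho_{2k+1}({\circ}^{2k+1}\omega)=(2k)!!\sum_{l=0}^k\frac{(2k-2l-1)!!}{(2k-2l)!!}\left(4l+\sum_{i=1}^{\mathscr C(\omega)}\frac{4C_i^2-2C_i}{C_i+1}\right),$$ where $C_1,\dots,C_{\mathscr C(\omega)}$ are the sizes of the cycles of $\omega$ and $(-1)!!=0!!=1$. In the theorem, $\rho_{\mathfrak a(\sigma,\tau)}(\sigma\tau^{-1})$ is computed with $\sigma\tau^{-1}={\circ}^{\mathfrak a(\sigma,\tau)}\omega$, the $\mathfrak a(\sigma,\tau)$ displayed fixed points being those corresponding to the atoms in $\mathfrak A(\sigma,\tau)$. The $O(d^{-1})$ may differ from term to term; its constant depends only on $L,R$. *)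

(* Defs.v *)
From HB Require Import structures.
From mathcomp Require Import all_boot all_order all_algebra all_fingroup.
From mathcomp Require Import complex.
From mathcomp Require Import all_classical all_reals all_analysis.

Set Implicit Arguments.
Unset Strict Implicit.
Unset Printing Implicit Defensive.

Import Order.TTheory GRing.Theory Num.Theory.
Import numFieldNormedType.Exports.

Local Open Scope classical_set_scope.
Local Open Scope ring_scope.
Local Open Scope complex_scope.

(* The cast selects the topology that the norm induces on a [numFieldType]. *)
Definition borel_mx (R : realType) (d : nat) : set (set 'M[R[i]]_d) :=
  <<s [set B | open (B : set 'M[R[i] : numFieldType]_d)] >>.

(* On the compact group of unitary matrices, the Haar probability measure is
   the unique Borel probability measure invariant under left translations. *)
Definition haar_unitary (R : realType) (d : nat) (disp : measure_display)
    (T : measurableType disp) (P : probability T R)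
    (Psi : T -> 'M[R[i]]_d) : Prop :=
  [/\ forall w, Psi w \is unitarymx,
      forall B, borel_mx B -> measurable (Psi @^-1` B)
    & forall (U : 'M[R[i]]_d) (B : set 'M[R[i]]_d),
        U \is unitarymx -> borel_mx B ->
        P ((fun w => U *m Psi w) @^-1` B) = P (Psi @^-1` B)].

Definition cexpectation (R : realType) (disp : measure_display)
    (T : measurableType disp) (P : probability T R) (X : T -> R[i]) : R[i] :=
  (fine 'E_P[fun w => complex.Re (X w)])
    +i* (fine 'E_P[fun w => complex.Im (X w)]).

(* [perm] composes from left to right, so this is the
   composition of functions [s \o t^-1]. *)
Definition permdiv (q : nat) (s t : 'S_q) : 'S_q := (t^-1 * s)%g.

Definition convolution (R : realType) (q : nat) (f g : 'S_q -> R) (s : 'S_q) : R :=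
  \sum_(t : 'S_q) f t * g (t^-1 * s)%g.

Definition convolution_unit (R : realType) (q : nat) (s : 'S_q) : R :=
  (s == 1%g)%:R.

(* The default value of [get] is irrelevant when [q <= d], since the
   convolution inverse then exists and is unique. *)
Definition Wg (R : realType) (q d : nat) : 'S_q -> R :=
  let cyc := fun s : 'S_q => d%:R ^+ #|porbits s| in
  get [set f : 'S_q -> R |
        convolution f cyc = @convolution_unit R q /\
        convolution cyc f = @convolution_unit R q].

(* [st] is the pair (sigma, tau): sigma matches the column (white) indices and
   tau the row (black) indices. *)
Definition covering_pairs (q d : nat) (j k j' k' : 'I_q -> 'I_d) :
    {set 'S_q * 'S_q} :=
  [set st : 'S_q * 'S_q |
    [forall l, (j l == j' (st.2 l)) && (k l == k' (st.1 l))]]%SET.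

Definition fcat (L R : nat) (X : Type) (f : 'I_L -> X) (g : 'I_R -> X)
    (i : 'I_(L + R)) : X :=
  match fintype.split i with inl l => f l | inr r => g r end.

(* The edges of atom [l] are the [l]-th psi and the [l]-th conjugate; they form
   a 2-circuit exactly when the conjugate follows the psi and conversely.  Such
   an [l] is a fixed point of [permdiv s t]. *)
Definition atom_circuits (L R : nat) (s t : 'S_(L + R)) : {set 'I_(L + R)} :=
  [set lshift R l | l : 'I_L & (s (lshift R l) == lshift R l)
                             && (t (lshift R l) == lshift R l)]%SET.

(* Double factorial; since subtraction on [nat] is truncated, [(2 * 0 - 1)!!]
   is [0!! = 1], in accordance with the convention [(-1)!! = 1]. *)
Fixpoint dfact (n : nat) : nat :=
  if n is m.+2 then (n * dfact m)%N else 1%N.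

(* [A] is the set of the K displayed fixed points of [s], and the cycles of
   omega are the cycles of [s] other than these. *)
Definition rho (R : realType) (q : nat) (A : {set 'I_q}) (s : 'S_q) : R :=
  let k := (#|A|)./2 in
  let cycle_term := fun C : R => (4 * C ^+ 2 - 2 * C) / (C + 1) in
  if odd #|A| then
    (dfact (2 * k)%N)%:R *
    \sum_(0 <= l < k.+1)
      (dfact (2 * k - 2 * l - 1)%N)%:R / (dfact (2 * k - 2 * l)%N)%:R *
      ((4 * l)%N%:R +
       \sum_(c in porbits s | [disjoint c & A]) cycle_term (#|c|%:R))
  else (dfact (2 * k - 1)%N)%:R.

(* Main.v *)
(* By the Weingarten formula the expectation is a sum over covering pairs (s, t)
   of the alternating sums
     Delta_A(p) = sum_(B subset of A) (-1/d)^|B| Wg_(~B)(p),   p = s t^-1,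
   where A is the set of atoms that s and t both fix and Wg_D is the Weingarten
   function of the permutations of D.  Since the generating function of cycles on
   D factors through the Jucys-Murphy element of a point a of D,
     d Wg_D(p) + sum_(i in D - a) Wg_D((a i) p) = Wg_(D - a)(p),
   where the right-hand side is 0 unless p fixes a.  When p moves a, the leading
   terms are those where (a i) splits a cycle, and one obtains the Catalan
   recursion for the leading coefficient of Wg_D.  When a lies in A, one obtains
     Delta_A(p) = - 1/d sum_(i <> a) Delta_(A - {a, i})((a i) p),
   and induction on |A| yields the order d^(-2 ceil(|A|/2)) and the constant rho,
   which satisfies the same recursion because consecutive Catalan numbers have
   ratio (4C - 2)/(C + 1).

   The Weingarten formula itself only uses the left invariance of the law: the
   mixed moments, as an operator on the tensor power of C^d, commute with the
   tensor powers of all unitaries, hence with those of all matrices, and for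
   q <= d such an operator is determined by its value on one tensor of distinct
   basis vectors. *)
Require Import Defs.
From HB Require Import structures.
From mathcomp Require Import all_boot all_order all_algebra all_fingroup.
From mathcomp Require Import reals.
From mathcomp Require Import zify ring lra.

Set Implicit Arguments.
Unset Strict Implicit.
Unset Printing Implicit Defensive.

Import Order.TTheory GRing.Theory Num.Theory.
Local Open Scope ring_scope.

(** * Cycles of a permutation multiplied by a transposition *)

Section PermCycles.
Variable T : finType.
Implicit Types (s : {perm T}) (x y z : T).
Local Open Scope group_scope.

Lemma expg_inj_porbit s x i j : (i < #|porbit s x|)%N -> (j < #|porbit s x|)%N ->
  (s ^+ i) x = (s ^+ j) x -> i = j.
Proof.
move=> hi hj e; apply/eqP; rewrite -(nth_uniq x _ _ (uniq_traject_porbit s x)) ?size_traject //.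
by rewrite !nth_traject // -!permX e.
Qed.

Lemma expg_card_porbit s x : (s ^+ #|porbit s x|) x = x.
Proof. by rewrite permX iter_porbit. Qed.

Lemma porbitX_lt s x y : y \in porbit s x ->
  exists2 i, (i < #|porbit s x|)%N & y = (s ^+ i) x.
Proof.
by rewrite porbit_traject => /trajectP[i hi ->]; exists i; rewrite ?permX.
Qed.

(** Products of permutations act from left to right, so [tperm x y * s] sends [y] to [s x] and then
    follows [s]: before reaching [y] the orbit meets neither [x] nor [y], and the transposition does
    nothing. *)
Lemma tperm_mulX s x k i : (k < #|porbit s x|)%N -> (i < k)%N ->
  let y := (s ^+ k) x in ((tperm x y * s) ^+ i.+1) y = (s ^+ i.+1) x.
Proof.
move=> hk; elim: i => [|i IH] hi /=; first by rewrite permM tpermR.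
have hiC := ltn_trans hi hk.
rewrite !(expgSr _ i.+1) !permM IH 1?ltnW //= tpermD //; apply/eqP.
  move=> e; have := @expg_inj_porbit s x 0 i.+1 _ hiC.
  by rewrite perm1 => /(_ (leq_ltn_trans (leq0n _) hk) e).
by move=> /(expg_inj_porbit hk hiC) e; rewrite e ltnn in hi.
Qed.

Lemma porbit_tperm_mul s x k : (0 < k < #|porbit s x|)%N ->
  let y := (s ^+ k) x in
  porbit (tperm x y * s) y =i [seq (s ^+ i) x | i <- iota 1 k].
Proof.
move=> /andP[k0 kC] y z; set s' := tperm x y * s.
have key i : (i < k)%N -> (s' ^+ i.+1) y = (s ^+ i.+1) x by apply: tperm_mulX.
have s'k : (s' ^+ k) y = y by case: k k0 {kC} @y @s' key => // k _ y s' ->.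
apply/idP/idP.
  move=> /porbitP[n ->]; elim: n => [|n /mapP[i]].
    by rewrite perm1; apply/mapP; exists k => //; rewrite mem_iota k0 add1n ltnS /=.
  rewrite mem_iota add1n ltnS => /andP[i0 ik].
  rewrite expgSr permM -[i in (s ^+ i) x](prednK i0) -key ?prednK // => ->.
  case: (ltngtP i k) ik => // [ik|->] _.
    rewrite -permM -expgSr key //; apply/mapP; exists i.+1 => //.
    by rewrite mem_iota ltnS.
  rewrite s'k -[s' y]/((s' ^+ 1) y) key //.
  by apply/mapP; exists 1%N => //; rewrite mem_iota.
move=> /mapP[i]; rewrite mem_iota add1n ltnS => /andP[i0 ik] ->.
by rewrite -(prednK i0) -key ?prednK // mem_porbit.
Qed.

Lemma card_porbit_tperm_mul s x k : (0 < k < #|porbit s x|)%N ->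
  let y := (s ^+ k) x in #|porbit (tperm x y * s) y| = k.
Proof.
move=> hk y; rewrite (eq_card (porbit_tperm_mul hk)).
rewrite (card_uniqP _) ?size_map ?size_iota //.
move/andP: hk => [k0 kC]; rewrite map_inj_in_uniq ?iota_uniq //.
move=> i j; rewrite !mem_iota !add1n !ltnS => /andP[_ hi] /andP[_ hj].
by apply: expg_inj_porbit; apply: leq_ltn_trans kC.
Qed.

(** The transposition is symmetric and [x] is reached from [y] in [#|porbit s x| - k] steps, so the
    roles of [x] and [y] can be exchanged. *)
Lemma card_porbit_tperm_mul' s x k : (0 < k < #|porbit s x|)%N ->
  let y := (s ^+ k) x in #|porbit (tperm x y * s) x| = (#|porbit s x| - k)%N.
Proof.
move=> hk y; have /andP[k0 kC] := hk.
have oy : porbit s y = porbit s x by apply: porbit_perm.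
have ex : x = (s ^+ (#|porbit s x| - k)) y.
  by rewrite /y -permM -expgD (subnKC (ltnW kC)) expg_card_porbit.
rewrite tpermC [in LHS]ex; apply: card_porbit_tperm_mul.
by rewrite oy subn_gt0 kC ltn_subrL k0 (leq_ltn_trans (leq0n _) kC).
Qed.

Lemma porbit_tperm_mul_notin s x y z : x \notin porbit s z -> y \notin porbit s z ->
  porbit (tperm x y * s) z = porbit s z.
Proof.
move=> xz yz; suff e n : ((tperm x y * s) ^+ n) z = (s ^+ n) z.
  apply/porbit_setP => u; apply/idP/idP=> /porbitP[i ->].
    by rewrite e mem_porbit.
  by rewrite -e mem_porbit.
elim: n => [|n IH]; first by rewrite perm1.
rewrite !expgSr !permM IH tpermD //; apply/eqP => e.
  by rewrite e mem_porbit in xz.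
by rewrite e mem_porbit in yz.
Qed.

Lemma porbit_tperm_mul_out s x y z : y \in porbit s x -> z \notin porbit s x ->
  porbit (tperm x y * s) z = porbit s z.
Proof.
move=> yx zx; apply: porbit_tperm_mul_notin; first by rewrite porbit_sym.
by rewrite porbit_sym; move: yx; rewrite -!eq_porbit_mem => /eqP ->; rewrite eq_porbit_mem.
Qed.

Lemma porbits_tperm_mul s x k : (0 < k < #|porbit s x|)%N ->
  let y := (s ^+ k) x in let s' := tperm x y * s in
  porbits s' = porbit s' x |: (porbit s' y |: (porbits s :\ porbit s x)).
Proof.
move=> hk y s'; have /andP[k0 kC] := hk.
have ys : y \in porbit s x by apply: mem_porbit.
have sx : porbit s' x \subset porbit s x.
  apply/subsetP => z; apply: contraTT => zx.
  by rewrite porbit_sym porbit_tperm_mul_out // porbit_sym.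
have sy : porbit s' y \subset porbit s x.
  apply/subsetP => z; apply: contraTT => zx.
  by rewrite porbit_sym porbit_tperm_mul_out // -eq_porbit_mem eq_sym
    porbit_perm eq_porbit_mem.
have xy : x \notin porbit s' y.
  rewrite porbit_tperm_mul //; apply/mapP => -[i].
  rewrite mem_iota add1n ltnS => /andP[i0 ik] e.
  have := @expg_inj_porbit s x 0 i _ (leq_ltn_trans ik kC).
  rewrite perm1 => /(_ (leq_ltn_trans (leq0n _) kC) e) e0.
  by rewrite -e0 in i0.
(* Both new cycles lie in the old one, are disjoint, and have sizes adding up to its size, so they
   exhaust it. *)
have U : porbit s' x :|: porbit s' y = porbit s x.
  apply/eqP; rewrite eqEcard subUset sx sy cardsU.
  rewrite card_porbit_tperm_mul // card_porbit_tperm_mul' // (subnK (ltnW kC)).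
  suff -> : porbit s' x :&: porbit s' y = set0 by rewrite cards0 subn0 leqnn.
  apply/setP => z; rewrite !inE; apply/negP => /andP[].
  by rewrite -!eq_porbit_mem => /eqP -> ; rewrite eq_porbit_mem (negPf xy).
apply/setP => c; rewrite !inE; apply/imsetP/idP.
  case=> z _ ->; have [zx|zx] := boolP (z \in porbit s x).
    by move: zx; rewrite -U inE -!eq_porbit_mem => /orP[->|->] //; rewrite orbT.
  by rewrite porbit_tperm_mul_out // imset_f // eq_porbit_mem zx !orbT.
case/or3P=> [/eqP->|/eqP->|/andP[cx /imsetP[z _ cz]]]; [by exists x|by exists y|].
by exists z => //; rewrite porbit_tperm_mul_out // -eq_porbit_mem -cz.
Qed.

Lemma prod_porbits_tperm_mul (R : comPzRingType) (f : nat -> R) s x k :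
    (0 < k < #|porbit s x|)%N ->
  (\prod_(c in porbits (tperm x ((s ^+ k)%g x) * s)%g) f #|c| =
   f k * f (#|porbit s x| - k)%N *
     \prod_(c in porbits s :\ porbit s x) f #|c|)%R.
Proof.
move=> hk; have /andP[k0 kC] := hk.
have ys : (s ^+ k) x \in porbit s x by apply: mem_porbit.
rewrite porbits_tperm_mul //; set s' := tperm _ _ * s.
have sx z : z \in porbit s x -> porbit s' z \notin porbits s :\ porbit s x.
  move=> zx; rewrite !inE; apply/negP => /andP[c /imsetP[u _ e]].
  have := porbit_id s' z; rewrite e => zu.
  move: c; rewrite e eq_porbit_mem.
  by move: zu zx; rewrite -!eq_porbit_mem => /eqP -> /eqP <-; rewrite eqxx.
have nxy : porbit s' x != porbit s' ((s ^+ k) x).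
  rewrite eq_porbit_mem porbit_tperm_mul //; apply/mapP => -[i].
  rewrite mem_iota add1n ltnS => /andP[i0 ik] e.
  have := @expg_inj_porbit s x 0 i _ (leq_ltn_trans ik kC).
  rewrite perm1 => /(_ (leq_ltn_trans (leq0n _) kC) e) e0.
  by rewrite -e0 in i0.
rewrite big_setU1 /=; last by rewrite in_setU1 negb_or nxy sx ?porbit_id.
rewrite big_setU1 ?sx //= card_porbit_tperm_mul // card_porbit_tperm_mul' //.
by rewrite GRing.mulrA [(f k * _)%R]GRing.mulrC.
Qed.

(** The Cayley length: the least number of transpositions whose product is [s]. *)
Definition perm_len s := (#|T| - #|porbits s|)%N.

Lemma perm_lenK s : (perm_len s + #|porbits s|)%N = #|T|.
Proof. by rewrite subnK // leq_imset_card. Qed.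

Lemma perm_len_split s x y : x != y -> x \in porbit s y ->
  perm_len s = (perm_len (tperm x y * s)).+1.
Proof.
move=> xy sxy; have := porbits_mul_tperm s x y; rewrite xy sxy /= => e.
move: e (perm_lenK s) (perm_lenK (tperm x y * s)).
move: #|T| #|porbits s| #|porbits (_ * _)%g| => c a b.
by move: (perm_len _) (perm_len _) => l l'; lia.
Qed.

Lemma perm_len_merge s x y : x \notin porbit s y ->
  perm_len (tperm x y * s) = (perm_len s).+1.
Proof.
move=> sxy; have := porbits_mul_tperm s x y.
have -> : x != y by apply: contraNneq sxy => ->; apply: porbit_id.
rewrite sxy /= => e.
move: e (perm_lenK s) (perm_lenK (tperm x y * s)).
move: #|T| #|porbits s| #|porbits (_ * _)%g| => c a b.
by move: (perm_len _) (perm_len _) => l l'; lia.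
Qed.

Lemma perm_len1 : perm_len 1 = 0%N.
Proof.
rewrite /perm_len card_imset ?subnn // => x y /eqP; rewrite eq_porbit_mem.
by move=> /porbitP[i ->]; rewrite expg1n perm1.
Qed.

Lemma porbit_fix s x : s x = x -> porbit s x = [set x].
Proof.
move=> sx; apply/setP => z; rewrite inE; apply/porbitP/eqP => [[i ->]|->].
  by rewrite permX; elim: i => //= i ->.
by exists 0%N; rewrite perm1.
Qed.

End PermCycles.

(** * Asymptotic expansions up to O(1/d) *)

Section Asymptotics.
Variable K : archiRealFieldType.
Implicit Types (f g : nat -> K) (a b c : K).

(* [f d = c + O(1/d)]; the junk value [C / 0 = 0] at [d = 0] is harmless since
   [d0] may be increased. *)
Definition asymp f c := exists C d0, forall d, (d0 <= d)%N ->
  `|f d - c| <= C / d%:R.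

Lemma asympP f c : asymp f c -> exists C d0,
  [/\ 0 < C, (0 < d0)%N & forall d, (d0 <= d)%N -> `|f d - c| <= C / d%:R].
Proof.
move=> [C [d0 h]]; exists (`|C| + 1), d0.+1.
split=> [||d hd]; rewrite ?ltr_wpDl //.
rewrite (le_trans (h _ (ltnW hd))) // ler_wpM2r ?invr_ge0 ?ler0n //.
by rewrite (le_trans (ler_norm _)) // lerDl.
Qed.

Lemma eq_asymp d0 f g c : (forall d, (d0 <= d)%N -> f d = g d) ->
  asymp f c -> asymp g c.
Proof.
move=> e [C [d1 h]]; exists C, (maxn d0 d1) => d.
by rewrite geq_max => /andP[h0 h1]; rewrite -e ?h.
Qed.

Lemma asymp_cst c : asymp (fun=> c) c.
Proof. by exists 0, 0%N => d _; rewrite subrr normr0 mul0r. Qed.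

Lemma asympD f g a b : asymp f a -> asymp g b ->
  asymp (fun d => f d + g d) (a + b).
Proof.
move=> [C [d0 h]] [C' [d0' h']]; exists (C + C'), (maxn d0 d0') => d.
rewrite geq_max => /andP[/h {}h /h' {}h'].
by rewrite opprD addrACA mulrDl; apply: le_trans (ler_normD _ _) (lerD _ _).
Qed.

Lemma asympM f g a b : asymp f a -> asymp g b ->
  asymp (fun d => f d * g d) (a * b).
Proof.
move=> /asympP[C [d0 [C0 d00 h]]] /asympP[C' [d0' [C'0 _ h']]].
exists (C * (`|b| + C') + `|a| * C'), (maxn d0 d0') => d.
rewrite geq_max => /andP[hd /h' {}h']; have {}h := h _ hd.
have d1 : 1 <= d%:R :> K by rewrite ler1n (leq_trans d00).
have gb : `|g d| <= `|b| + C'.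
  rewrite -[g d](subrK b) addrC (le_trans (ler_normD _ _)) // lerD2l.
  by rewrite (le_trans h') // ler_pdivrMr ?ler_peMr // ?(lt_le_trans ltr01) // ltW.
have -> : f d * g d - a * b = (f d - a) * g d + a * (g d - b) by ring.
rewrite [leRHS]mulrDl (le_trans (ler_normD _ _)) // !normrM lerD //.
  by rewrite mulrAC ler_pM.
by rewrite -mulrA ler_wpM2l.
Qed.

Lemma asympN f a : asymp f a -> asymp (fun d => - f d) (- a).
Proof.
by move=> [C [d0 h]]; exists C, d0 => d /h; rewrite -opprD normrN.
Qed.

Lemma asymp_sum (I : Type) (r : seq I) (P : pred I) (F : I -> nat -> K) G :
  (forall i, P i -> asymp (F i) (G i)) ->
  asymp (fun d => \sum_(i <- r | P i) F i d) (\sum_(i <- r | P i) G i).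
Proof.
move=> h; elim: r => [|i r IH].
  by apply: (@eq_asymp 0%N (fun=> 0)) => [d _|]; rewrite big_nil //; apply: asymp_cst.
rewrite big_cons; case: (boolP (P i)) => Pi.
  apply: (@eq_asymp 0%N (fun d => F i d + \sum_(j <- r | P j) F j d)) => [d _|].
    by rewrite big_cons Pi.
  by apply: asympD; first exact: h.
by apply: (@eq_asymp 0%N) IH => d _; rewrite big_cons (negPf Pi).
Qed.

Lemma asymp_prod (I : Type) (r : seq I) (P : pred I) (F : I -> nat -> K) G :
  (forall i, P i -> asymp (F i) (G i)) ->
  asymp (fun d => \prod_(i <- r | P i) F i d) (\prod_(i <- r | P i) G i).
Proof.
move=> h; elim: r => [|i r IH].
  by apply: (@eq_asymp 0%N (fun=> 1)) => [d _|]; rewrite big_nil //; apply: asymp_cst.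
rewrite big_cons; case: (boolP (P i)) => Pi.
  apply: (@eq_asymp 0%N (fun d => F i d * \prod_(j <- r | P j) F j d)) => [d _|].
    by rewrite big_cons Pi.
  by apply: asympM; first exact: h.
by apply: (@eq_asymp 0%N) IH => d _; rewrite big_cons (negPf Pi).
Qed.

Lemma natr_gt_eventually c : exists d0, forall d, (d0 <= d)%N -> c < d%:R :> K.
Proof.
have := Num.Theory.archi_boundP (normr_ge0 c).
set d0 := Num.bound _ => h; exists d0 => d hd.
by rewrite (le_lt_trans (ler_norm c)) // (lt_le_trans h) ?ler_nat.
Qed.

Lemma asympV f c : c != 0 -> asymp f c -> asymp (fun d => (f d)^-1) c^-1.
Proof.
move=> c0 /asympP[C [d0 [C0 d00 h]]].
have c0' : 0 < `|c| by rewrite normr_gt0.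
(* Beyond this threshold the error [C / d] is below [|c| / 2], which keeps [f d] away from zero. *)
have [d1 h1] := natr_gt_eventually (2 * C / `|c|).
exists (2 * C / `|c| ^+ 2), (maxn d0 d1) => d.
rewrite geq_max => /andP[hd /h1 {}h1]; have {}h := h _ hd.
have d1' : 0 < d%:R :> K by rewrite ltr0n (leq_trans d00).
have fb : `|c| / 2 <= `|f d|.
  have : `|c| <= `|f d - c| + `|f d|.
    by rewrite distrC -{1}[c](subrK (f d)) ler_normD.
  have : C / d%:R <= `|c| / 2.
    by move: h1; rewrite ltr_pdivrMr // ler_pdivrMr //; lra.
  lra.
have fn0 : f d != 0 by rewrite -normr_gt0; apply: lt_le_trans fb; rewrite divr_gt0.
have -> : (f d)^-1 - c^-1 = (c - f d) * ((f d)^-1 * c^-1) by field; rewrite fn0 c0.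
rewrite normrM distrC normrM !normfV.
have -> : 2 * C / `|c| ^+ 2 / d%:R = C / d%:R * ((`|c| / 2)^-1 * `|c|^-1).
  by field; rewrite !gt_eqF.
rewrite ler_pM ?mulr_ge0 ?invr_ge0 // ler_wpM2r ?invr_ge0 //.
by rewrite lef_pV2 ?posrE ?divr_gt0 // normr_gt0.
Qed.

Lemma asymp_neq0 f c : c != 0 -> asymp f c ->
  exists d0, forall d, (d0 <= d)%N -> f d != 0.
Proof.
move=> c0 [C [d0 h]]; have c0' : 0 < `|c| by rewrite normr_gt0.
have [d1 h1] := natr_gt_eventually (`|C| / `|c|).
exists (maxn d0 d1).+1 => d.
rewrite -[(_ < _)%N]/((maxn d0 d1).+1 <= d)%N => hd.
have d1' : 0 < d%:R :> K by rewrite ltr0n (leq_ltn_trans _ hd).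
have {hd} := ltnW hd; rewrite geq_max => /andP[/h {}h /h1 {}h1].
apply: contraTneq h => ->; rewrite sub0r normrN -ltNge ltr_pdivrMr //.
by rewrite mulrC (le_lt_trans (ler_norm C)) // -ltr_pdivrMr.
Qed.

(** Uniqueness of the limit; through it an exact recursion in [d] passes to leading coefficients. *)
Lemma asymp_inj f a b : asymp f a -> asymp f b -> a = b.
Proof.
move=> fa fb; apply/eqP; rewrite -subr_eq0; apply/negPn/negP => ab.
have := asympD fa (asympN fb) => /(asymp_neq0 ab)[d0 /(_ _ (leqnn d0))].
by rewrite subrr eqxx.
Qed.

Lemma asympVX n : (0 < n)%N -> asymp (fun d => d%:R ^- n) 0.
Proof.
move=> n0; exists 1, 1%N => d hd; rewrite subr0 normfV normrX normr_nat.
rewrite div1r lef_pV2 ?posrE ?exprn_gt0 ?ltr0n // ler_eXnr ?ler1n //.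
Qed.

Lemma asymp_det n (A : nat -> 'M[K]_n) (B : 'M[K]_n) :
  (forall i j, asymp (fun d => A d i j) (B i j)) ->
  asymp (fun d => \det (A d)) (\det B).
Proof.
move=> h; rewrite /determinant; apply: asymp_sum => s _.
by apply: asympM; [apply: asymp_cst | apply: asymp_prod].
Qed.

(** By Cramer's rule the entries of the inverse are cofactors divided by a determinant with nonzero
    limit. *)
Lemma asymp_invmx n (A : nat -> 'M[K]_n) (B : 'M[K]_n) : B \in unitmx ->
  (forall i j, asymp (fun d => A d i j) (B i j)) ->
  forall i j, asymp (fun d => invmx (A d) i j) (invmx B i j).
Proof.
move=> Bu h i j; have dB : \det B != 0 by rewrite -unitfE -unitmxE.
have [d0 hd0] := asymp_neq0 dB (asymp_det h).
rewrite /invmx Bu mxE; apply: (@eq_asymp d0 (fun d => (\det (A d))^-1 * (\adj (A d)) i j)).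
  by move=> d /hd0 h0; rewrite unitmxE unitfE h0 [RHS]mxE.
apply: asympM; first by apply: asympV => //; apply: asymp_det.
rewrite mxE /cofactor.
apply: (@eq_asymp 0%N (fun d => (-1) ^+ (j + i) * \det (row' j (col' i (A d))))).
  by move=> d _; rewrite mxE.
apply: asympM; first exact: asymp_cst.
apply: asymp_det => k l; rewrite !mxE.
by apply: (@eq_asymp 0%N (fun d => A d (lift j k) (lift i l))) => // d _; rewrite !mxE.
Qed.

End Asymptotics.

(** * Catalan numbers and the leading coefficient of the Weingarten function *)

Section Catalan.
Variable K : realFieldType.

(** Defined by the ratio of consecutive terms, with values in a field because of the division; this
    ratio is what reappears in [rho]. *)
Fixpoint catalan (n : nat) : K :=
  if n is m.+1 then (4 * m%:R + 2) / (m%:R + 2) * catalan m else 1.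

Lemma catalanS n : catalan n.+1 = (4 * n%:R + 2) / (n%:R + 2) * catalan n.
Proof. by []. Qed.

(* With [S n] the convolution, the symmetry [i <-> n - i] and the two-term
   recursion of [catalan] give [(n + 3) / 2 * S n.+1 = (2 n + 2) * S n + catalan n.+1]. *)
Lemma catalan_conv n :
  \sum_(i < n.+1) catalan i * catalan (n - i) = catalan n.+1.
Proof.
pose S n := \sum_(i < n.+1) catalan i * catalan (n - i).
have sym m : \sum_(i < m.+1) i%:R * (catalan i * catalan (m - i)) = m%:R / 2 * S m.
  have e : \sum_(i < m.+1) i%:R * (catalan i * catalan (m - i)) =
      \sum_(i < m.+1) (m%:R - i%:R) * (catalan i * catalan (m - i)).
    rewrite (reindex_inj rev_ord_inj) /=; apply: eq_bigr => i _.
    have im : (i <= m)%N by rewrite -ltnS.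
    by rewrite subSS natrB // subKn // [catalan (m - i) * _]mulrC.
  have : \sum_(i < m.+1) i%:R * (catalan i * catalan (m - i)) +
      \sum_(i < m.+1) i%:R * (catalan i * catalan (m - i)) = m%:R * S m.
    rewrite {1}e -big_split mulr_sumr; apply: eq_bigr => i _ /=.
    by rewrite -mulrDl subrK.
  by lra.
have step m : (m%:R + 3) / 2 * S m.+1 = (2 * m%:R + 2) * S m + catalan m.+1.
  have e1 : \sum_(i < m.+1) (i%:R + 2) * (catalan i.+1 * catalan (m - i)) =
            (2 * m%:R + 2) * S m.
    transitivity (\sum_(i < m.+1) (4 * (i%:R * (catalan i * catalan (m - i))) +
        2 * (catalan i * catalan (m - i)))).
      apply: eq_bigr => i _ /=.
      have i2 : i%:R + 2 != 0 :> K by rewrite gt_eqF // ltr_wpDl.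
      by field.
    by rewrite big_split -!mulr_sumr sym /= -/(S m); set s := S m; field.
  have : \sum_(i < m.+2) (i%:R + 1) * (catalan i * catalan (m.+1 - i)) =
      (m.+1%:R / 2 + 1) * S m.+1.
    rewrite mulrDl -sym mul1r -big_split; apply: eq_bigr => i _ /=; ring.
  rewrite big_ord_recl.
  have -> : \sum_(i < m.+1) ((lift ord0 i)%:R + 1) *
      (catalan (lift ord0 i) * catalan (m.+1 - lift ord0 i)) = (2 * m%:R + 2) * S m.
    rewrite -e1; apply: eq_bigr => i _; rewrite lift0 subSS -natr1.
    by congr (_ * _); ring.
  rewrite -[X in X + _ = _ -> _]/((0 + 1) * (1 * catalan (m.+1 - 0))) subn0 add0r !mul1r.
  by rewrite -natr1 => e2; rewrite [RHS]addrC e2; field.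
suff : S n = catalan n.+1 by [].
elim: n => [|n IH]; first by rewrite /S big_ord1 /=; field.
have := step n; rewrite IH => e.
have n3 : n%:R + 3 != 0 :> K by rewrite gt_eqF // ltr_wpDl.
have n3' : n.+1%:R + 2 != 0 :> K by rewrite gt_eqF // ltr_wpDl.
apply: (mulfI (_ : (n%:R + 3) / 2 != 0)).
  by rewrite mulf_neq0 // invr_eq0 pnatr_eq0.
rewrite e [catalan n.+2]catalanS; move: (catalan n.+1) => c.
have {}n3' : n%:R + 1 + 2 != 0 :> K by rewrite natr1.
by rewrite -[n.+1%:R]natr1; field.
Qed.

Lemma catalan_gt0 n : 0 < catalan n.
Proof.
by elim: n => //= n IH; rewrite mulr_gt0 ?divr_gt0 // ltr_wpDl ?mulr_ge0.
Qed.

(** The signed Catalan number that a cycle of length [n] contributes to the Moebius function of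
    noncrossing partitions. *)
Definition cycle_weight n : K := (-1) ^+ n.-1 * catalan n.-1.

Lemma cycle_weightS n : (0 < n)%N ->
  cycle_weight n.+1 = - ((4 * n%:R - 2) / (n%:R + 1)) * cycle_weight n.
Proof.
case: n => // n _; rewrite /cycle_weight /= exprS.
have n2 : n%:R + 2 != 0 :> K by rewrite gt_eqF // ltr_wpDl.
have n2' : n%:R + 1 + 1 != 0 :> K by rewrite -addrA.
by rewrite -natr1; field; rewrite [1 + _]addrC.
Qed.

(** The Catalan convolution: the signs of the two factors multiply to [(-1) ^ n], opposite to the
    sign in [cycle_weight n]. *)
Lemma cycle_weight_conv n : (1 < n)%N ->
  \sum_(1 <= k < n) cycle_weight k * cycle_weight (n - k) = - cycle_weight n.
Proof.
case: n => [|[|n]] // _; rewrite big_add1 big_mkord /=.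
rewrite /cycle_weight -[n.+2.-1]/n.+1 exprS mulN1r mulNr opprK -catalan_conv mulr_sumr.
apply: eq_bigr => i _; have im : (i <= n)%N by rewrite -ltnS.
by rewrite subSS subSn //= mulrACA -exprD subnKC.
Qed.

Lemma cycle_weight_neq0 n : cycle_weight n != 0.
Proof. by rewrite mulf_neq0 ?signr_eq0 // gt_eqF // catalan_gt0. Qed.

End Catalan.

(** * The Moebius function of a permutation under splitting and merging of cycles *)

Section Moebius.
Variables (K : realFieldType) (T : finType).
Implicit Types (s : {perm T}) (x y a : T).

Definition moebius s : K := \prod_(c in porbits s) cycle_weight K #|c|.

Lemma moebius_neq0 s : moebius s != 0.
Proof. by apply/prodf_neq0 => c _; apply: cycle_weight_neq0. Qed.

Lemma moebius1 : moebius 1%g = 1.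
Proof.
rewrite /moebius big1 // => c /imsetP[x _ ->].
by rewrite porbit_fix ?perm1 // cards1 /cycle_weight mul1r.
Qed.

Lemma sum_porbit (M : nmodType) s x (F : T -> M) :
  \sum_(y in porbit s x | y != x) F y =
  \sum_(1 <= k < #|porbit s x|) F ((s ^+ k)%g x).
Proof.
set C := #|porbit s x|.
have u : uniq [seq (s ^+ k)%g x | k <- index_iota 1 C].
  rewrite map_inj_in_uniq ?iota_uniq // => i j.
  by rewrite !mem_index_iota => /andP[_ hi] /andP[_ hj]; apply: expg_inj_porbit.
rewrite -(big_map (fun k => (s ^+ k)%g x) xpredT F) (big_uniq _ u) /=.
apply: eq_bigl => y; apply/andP/mapP.
  move=> [/porbitX_lt[k kC ->] kx]; exists k => //.
  by rewrite mem_index_iota kC andbT lt0n; apply: contraNneq kx => ->; rewrite perm1.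
move=> [k]; rewrite mem_index_iota => /andP[k0 kC] ->.
split; first exact: mem_porbit.
apply/eqP => e; have := @expg_inj_porbit _ s x 0 k _ kC.
by rewrite perm1 e => /(_ (leq_ltn_trans (leq0n _) kC) erefl) e0; rewrite -e0 in k0.
Qed.

(** Multiplying by [tperm x (s^k x)] cuts the cycle of [x], of length [C], into cycles of lengths
    [k] and [C - k], so the sum is the convolution recursion for the weight of that cycle. *)
Lemma moebius_split s x : s x != x ->
  moebius s = - \sum_(y in porbit s x | y != x) moebius (tperm x y * s)%g.
Proof.
move=> sx; rewrite sum_porbit.
have C1 : (1 < #|porbit s x|)%N.
  rewrite (cardsD1 x) porbit_id add1n ltnS card_gt0; apply/set0Pn; exists (s x).
  by rewrite !inE sx -[s x]/((s ^+ 1)%g x) mem_porbit.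
rewrite {1}/moebius (bigD1 (porbit s x)) ?imset_f //=.
rewrite -[cycle_weight K _]opprK -cycle_weight_conv // mulNr mulr_suml.
congr (- _); apply: eq_big_nat => k hk.
rewrite /moebius prod_porbits_tperm_mul //; congr (_ * _).
by apply: eq_bigl => c; rewrite !inE andbC.
Qed.

Lemma porbit_merge s a y : s a = a -> a != y ->
  y \in porbit (tperm a y * s)%g a.
Proof.
move=> sa ay; set s1 := (_ * s)%g.
have ays : a \notin porbit s y by rewrite porbit_sym porbit_fix // inE eq_sym.
(* Otherwise multiplying by the transposition again would merge cycles a second time and raise the
   length by two, although it gives back [s]. *)
rewrite porbit_sym; apply/negPn/negP => h.
have := perm_len_merge h; rewrite tpermKg perm_len_merge // => e.
by move: e; move: (perm_len s) => n; lia.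
Qed.

Lemma porbit_merge_expg s a y : s a = a -> a != y ->
  let s1 := (tperm a y * s)%g in
  y = (s1 ^+ #|porbit s y|)%g a /\ #|porbit s1 a| = #|porbit s y|.+1.
Proof.
move=> sa ay s1; have e : s = (tperm a y * s1)%g by rewrite tpermKg.
have := porbit_merge sa ay; rewrite -/s1 => /porbitX_lt[k kC yk].
have hk : (0 < k < #|porbit s1 a|)%N.
  by rewrite kC andbT lt0n; apply: contraNneq ay => k0; rewrite yk k0 perm1.
have cy := card_porbit_tperm_mul hk; have ca := card_porbit_tperm_mul' hk.
rewrite /= -yk -e in cy ca; rewrite porbit_fix // cards1 in ca.
by rewrite cy; split=> //; move: ca hk; move: #|porbit s1 a| => n; lia.
Qed.

(** The fixed point [a] is inserted into the cycle of [y], whose length grows from [C] to [C + 1];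
    the factor is the ratio of the two weights. *)
Lemma moebius_merge s a y : s a = a -> a != y ->
  let C := #|porbit s y|%:R in
  moebius (tperm a y * s)%g = - ((4 * C - 2) / (C + 1)) * moebius s.
Proof.
move=> sa ay C; set s1 := (_ * s)%g.
have e : s = (tperm a y * s1)%g by rewrite tpermKg.
have [] := porbit_merge_expg sa ay; rewrite -/s1 => yk ca.
have C0 : (0 < #|porbit s y|)%N by rewrite lt0n card_porbit_neq0.
have hk : (0 < #|porbit s y| < #|porbit s1 a|)%N by rewrite ca C0 /=.
have := @prod_porbits_tperm_mul _ _ (cycle_weight K) _ _ _ hk.
rewrite -yk -e ca => e2.
rewrite /moebius e2 (bigD1 (porbit s1 a)) ?imset_f //= ca /C cycle_weightS //.
have -> k : cycle_weight K (k.+1 - k) = 1 by rewrite subSnn /cycle_weight mulr1.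
rewrite mulr1 -mulrA; congr (_ * (_ * _)).
by apply: eq_bigl => c; rewrite !inE andbC.
Qed.

End Moebius.

(** * Convolution inverses and the Weingarten function of a subset *)

Section Convolution.
Variables (K : fieldType) (gT : finGroupType).
Implicit Types (f g h : gT -> K).
Local Open Scope group_scope.

Definition gconv f g (s : gT) : K := (\sum_(t : gT) f t * g (t^-1 * s)%g)%R.

(** The regular representation: convolution becomes the matrix product, so a one-sided inverse is
    two-sided and unique. *)
Definition gconv_mx f : 'M[K]_#|gT| :=
  (\matrix_(i, j) f ((enum_val i)^-1 * enum_val j)%g)%R.

Lemma gconv_mxM f g : (gconv_mx f *m gconv_mx g = gconv_mx (gconv f g))%R.
Proof.
apply/matrixP => i j; rewrite !mxE.
transitivity (\sum_(u : gT) f ((enum_val i)^-1 * u)%g * g (u^-1 * enum_val j)%g)%R.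
  by rewrite [RHS](reindex _ (onW_bij _ (@enum_val_bij gT))) /=;
     apply: eq_bigr => k _; rewrite !mxE.
rewrite (reindex_inj (mulgI (enum_val i))) /=; apply: eq_bigr => u _.
by rewrite mulKg invMg mulgA.
Qed.

Lemma gconv_mx_inj f g : gconv_mx f = gconv_mx g -> f =1 g.
Proof.
move=> /matrixP e s; have := e (enum_rank 1) (enum_rank s).
by rewrite !mxE !enum_rankK invg1 mul1g.
Qed.

Lemma eq_gconv_mx f g : f =1 g -> gconv_mx f = gconv_mx g.
Proof. by move=> e; apply/matrixP => i j; rewrite !mxE e. Qed.

Definition gdelta (s : gT) : K := ((s == 1%g)%:R)%R.

Lemma gconv_mx_delta : gconv_mx gdelta = 1%:M%R.
Proof.
apply/matrixP => i j; rewrite !mxE /gdelta -eq_mulVg1.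
by rewrite (can_eq enum_valK).
Qed.

Lemma gconvC f g : gconv f g =1 gdelta -> gconv g f =1 gdelta.
Proof.
move=> /eq_gconv_mx; rewrite -gconv_mxM gconv_mx_delta => /mulmx1C.
by rewrite gconv_mxM -gconv_mx_delta => /gconv_mx_inj.
Qed.

Lemma gconvA f g h : gconv f (gconv g h) =1 gconv (gconv f g) h.
Proof. by apply: gconv_mx_inj; rewrite -!gconv_mxM mulmxA. Qed.

Lemma gconv_uniq f f' g : gconv f g =1 gdelta -> gconv f' g =1 gdelta -> f =1 f'.
Proof.
move=> /eq_gconv_mx e /eq_gconv_mx e'; apply: gconv_mx_inj.
rewrite -!gconv_mxM gconv_mx_delta in e e'.
by rewrite -[LHS]mulmx1 -(mulmx1C e') mulmxA e mul1mx.
Qed.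

Lemma gconvV f g s : gconv (f \o invg) (g \o invg) s = gconv g f s^-1.
Proof.
rewrite /gconv (reindex_inj (mulgI s)); apply: eq_bigr => t _ /=.
by rewrite !invMg !invgK mulKg GRing.mulrC.
Qed.

End Convolution.

Section Weingarten.
Variables (K : archiRealFieldType) (T : finType).
Implicit Types (s t : {perm T}) (D A B : {set T}) (x y n : T) (d : nat).

Lemma perm_on_1 s : perm_on set0 s -> s = 1%g.
Proof.
move=> h; apply/permP => x; rewrite perm1; apply/eqP/negPn/negP => sx.
by have := subsetP h x sx; rewrite inE.
Qed.

Lemma perm_onMl D s t : perm_on D s -> perm_on D (s * t)%g = perm_on D t.
Proof.
move=> hs; apply/idP/idP => [h|]; last exact: perm_onM.
by rewrite -[t](mulKg s); apply: perm_onM => //; apply: perm_onV.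
Qed.

Lemma perm_lenV s : perm_len s^-1%g = perm_len s.
Proof. by rewrite /perm_len porbitsV. Qed.

Lemma perm_len_tpermM_le s x y : (perm_len (tperm x y * s)%g <= (perm_len s).+1)%N.
Proof.
have [->|xy] := eqVneq x y; first by rewrite tperm1 mul1g leqnSn.
have [h|h] := boolP (x \in porbit s y); last by rewrite perm_len_merge.
by rewrite (perm_len_split xy h) ltnW // ltnW.
Qed.

Lemma exists_perm_split s : s != 1%g -> exists x y,
  perm_len s = (perm_len (tperm x y * s)%g).+1.
Proof.
move=> s1; have [x sx] : exists x, x != s x.
  apply/existsP; rewrite -negb_forall; apply: contra s1 => /forallP h.
  by apply/eqP/permP => x; rewrite perm1 -(eqP (h x)).
exists x, (s x); apply: perm_len_split => //.
by rewrite porbit_sym -[s x]/((s ^+ 1)%g x) mem_porbit.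
Qed.

(** Peel transpositions off [s]: each lowers its length by one and changes the length of the product
    by at most one. *)
Lemma perm_lenM s t : (perm_len (s * t)%g <= perm_len s + perm_len t)%N.
Proof.
elim: {s}(perm_len s) {-2}s (erefl (perm_len s)) => [|l IH] s e.
  have -> : s = 1%g; last by rewrite mul1g leq_addl.
  by apply/eqP/negPn/negP => /exists_perm_split[x [y]]; rewrite e.
have s1 : s != 1%g by apply: contra_eq_neq e => ->; rewrite perm_len1.
have [x [y]] := exists_perm_split s1; rewrite e => -[e'].
rewrite -{1}[s](tpermKg x y) -mulgA (leq_trans (perm_len_tpermM_le _ _ _)) //.
by rewrite addSn ltnS e' IH.
Qed.

Lemma perm_len_gt0 s : s != 1%g -> (0 < perm_len s)%N.
Proof. by move=> /exists_perm_split[x [y ->]]. Qed.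

(* On permutations [s] of [D] this is [d] to the number of cycles of [s] in [D].
   Working with subsets [D] of a fixed [T] keeps all the Weingarten functions
   that arise from deleting atoms on one and the same group. *)
Definition gram D d s : K :=
  if perm_on D s then d%:R ^+ #|D| / d%:R ^+ perm_len s else 0.

Lemma gramV D d s : gram D d s^-1%g = gram D d s.
Proof.
rewrite /gram perm_lenV; congr (if _ then _ else _).
by apply/idP/idP => /perm_onV; rewrite ?invgK.
Qed.

(* The matrix of the convolution by [gram D d], conjugated by the powers
   [d ^ perm_len]: by the triangle inequality for [perm_len] it converges, and
   its limit is unitriangular with respect to [perm_len]. *)
Definition scaled_gram D d : 'M[K]_#|{perm T}| :=
  \matrix_(i, j) let s := enum_val i in let t := enum_val j in
   let st := (s^-1 * t)%g in
   if perm_on D st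
   then d%:R ^- (perm_len s + perm_len st - perm_len t) else 0.

Definition limit_gram D : 'M[K]_#|{perm T}| :=
  \matrix_(i, j) let s := enum_val i in let t := enum_val j in
   let st := (s^-1 * t)%g in
   (perm_on D st && (perm_len s + perm_len st == perm_len t)%N)%:R.

Lemma perm_len_triangle s t :
  (perm_len t <= perm_len s + perm_len (s^-1 * t)%g)%N.
Proof. by rewrite -{1}[t](mulKVg s) perm_lenM. Qed.

Lemma asymp_scaled_gram D i j :
  asymp (fun d => scaled_gram D d i j) (limit_gram D i j).
Proof.
rewrite mxE /=; set s := enum_val i; set t := enum_val j.
set st : {perm T} := (s^-1 * t)%g.
have [h|h] := boolP (perm_on D st) => /=; last first.
  apply: (@eq_asymp _ 0%N (fun=> 0)) (@asymp_cst K 0) => d _.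
  by rewrite mxE /= -/s -/t -/st (negPf h).
apply: (@eq_asymp _ 0%N (fun d => d%:R ^- (perm_len s + perm_len st - perm_len t))).
  by move=> d _; rewrite mxE /= -/s -/t -/st h.
have := perm_len_triangle s t; rewrite -/st leq_eqVlt => /orP[/eqP e|lt].
  rewrite -e eqxx subnn; apply: (@eq_asymp _ 0%N (fun=> 1)); last exact: asymp_cst.
  by move=> d _; rewrite expr0 invr1.
by rewrite gtn_eqF //; apply: asympVX; rewrite subn_gt0.
Qed.

Lemma limit_gram_unit D : limit_gram D \in unitmx.
Proof.
rewrite -row_free_unit; apply: inj_row_free => v /rowP v0.
(* Induction on the length: besides [v 0 i], the [i]-th equation only involves entries at strictly
   shorter permutations. *)
suff h l : forall i, perm_len (enum_val i) = l -> v 0 i = 0.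
  by apply/rowP => i; rewrite mxE (h _ i erefl).
elim/ltn_ind: l => l IH i e.
have := v0 i; rewrite !mxE (bigD1 i) //= mxE /= mulVg perm_on1 perm_len1 addn0 eqxx mulr1.
rewrite big1 ?addr0 // => k ki; rewrite mxE /=.
case: andP => [[_ /eqP ek]|_]; last by rewrite mulr0.
rewrite (IH (perm_len (enum_val k))) ?mul0r //.
rewrite -e -ek -[ltnLHS]addn0 ltn_add2l perm_len_gt0 // -eq_mulVg1.
by apply: contraNneq ki => /enum_val_inj ->.
Qed.

(* The convolution inverse of [gram D d], for [d] large; undoing the scaling
   gives the sharp order [d ^ - (#|D| + perm_len s)] for free. *)
Definition wg D d s : K :=
  invmx (scaled_gram D d) (enum_rank 1%g) (enum_rank s) / d%:R ^+ (#|D| + perm_len s).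

Definition wg_limit D s : K :=
  invmx (limit_gram D) (enum_rank 1%g) (enum_rank s).

Lemma asymp_wg_limit D s :
  asymp (fun d => d%:R ^+ (#|D| + perm_len s) * wg D d s) (wg_limit D s).
Proof.
apply: (@eq_asymp _ 1%N (fun d => invmx (scaled_gram D d) (enum_rank 1%g) (enum_rank s))).
  by move=> d d0; rewrite mulrC divfK // expf_neq0 // pnatr_eq0 -lt0n.
by apply: asymp_invmx; [exact: limit_gram_unit | exact: asymp_scaled_gram].
Qed.

(** Undoes the scaling in [gconv_wg_gram]; the hypothesis [b <= a + c], there the triangle
    inequality, keeps the natural subtraction exact. *)
Lemma expr_triangle (x : K) m a b c : x != 0 -> (b <= a + c)%N ->
  x ^- (a + c - b) / x ^+ b = (x ^+ (m + a))^-1 * (x ^+ m / x ^+ c).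
Proof.
move=> x0 h; rewrite -invfM -exprD subnK // !exprD.
have := expf_neq0 m x0; have := expf_neq0 a x0; have := expf_neq0 c x0.
by move: (x ^+ m) (x ^+ a) (x ^+ c) => u v w w0 v0 u0; field; rewrite u0 v0 w0.
Qed.

Lemma gconv_wg_gram D : exists d0, forall d, (d0 <= d)%N ->
  gconv (wg D d) (gram D d) =1 @gdelta K _.
Proof.
have u := limit_gram_unit D; rewrite unitmxE unitfE in u.
have [d0 hd0] := asymp_neq0 u (asymp_det (asymp_scaled_gram D)).
exists d0.+1 => d hd s; have {}hd0 := hd0 _ (ltnW hd).
have dn0 : d%:R != 0 :> K by rewrite pnatr_eq0 -lt0n (leq_ltn_trans _ hd).
(* The entry in the row of the identity and the column of [s] is the convolution at [s], up to the
   power [d ^ perm_len s]. *)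
have := mulVmx (_ : scaled_gram D d \in unitmx).
rewrite unitmxE unitfE => /(_ hd0) /matrixP /(_ (enum_rank 1%g) (enum_rank s)).
rewrite !mxE (can_eq enum_rankK) => e.
have -> : gdelta K s = (s == 1%g)%:R / d%:R ^+ perm_len s.
  rewrite /gdelta; case: eqP => [->|_]; last by rewrite mul0r.
  by rewrite perm_len1 divr1.
rewrite eq_sym -e mulr_suml /gconv.
rewrite (reindex _ (onW_bij _ (@enum_val_bij {perm T}))) /=.
apply: eq_bigr => i _; rewrite mxE /wg /gram !enum_valK enum_rankK.
case: ifP => _; last by rewrite !mulr0 mul0r.
rewrite -!mulrA; congr (_ * _).
by apply/esym/expr_triangle => //; apply: perm_len_triangle.
Qed.

End Weingarten.

(** * The recursion and the asymptotics of the Weingarten function *)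

Section WeingartenRecursion.
Variables (K : archiRealFieldType) (T : finType).
Implicit Types (s t : {perm T}) (D A B : {set T}) (x y n : T) (d : nat).

Lemma porbit_sub D s n : perm_on D s -> n \in D -> porbit s n \subset D.
Proof.
move=> hs nD; apply/subsetP => _ /porbitP[i ->].
elim: i => [|i IH]; first by rewrite perm1.
by rewrite expgSr permM perm_closed.
Qed.

(* [s] is uniquely of the form [u] or [tperm n i * u] with [u] fixing [n]. *)
Lemma gramM_rec D d s n : d%:R != 0 :> K -> n \in D ->
  gram K D d s = d%:R * gram K (D :\ n) d s +
    \sum_(i in D :\ n) gram K (D :\ n) d (tperm n i * s)%g.
Proof.
move=> d0 nD; have cD : #|D| = #|D :\ n|.+1 by rewrite (cardsD1 n) nD.
have sub : D :\ n \subset D by apply: subsetDl.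
have onD i : i \in D -> perm_on D (tperm n i).
  move=> iD; apply/subsetP => x; rewrite inE; apply: contraR => xD.
  by rewrite tpermD //; apply: contraNneq xD => <-.
have [hs|hs] := boolP (perm_on D s); last first.
  rewrite {1}/gram (negPf hs) {1}/gram ifF; last first.
    by apply: contraNF hs => h; apply: subset_trans h sub.
  rewrite mulr0 add0r big1 // => i; rewrite inE => /andP[_ iD].
  rewrite /gram ifF //; apply: contraNF hs => h.
  by rewrite -(perm_onMl _ (onD _ iD)); apply: subset_trans h sub.
have fixD u : perm_on (D :\ n) u = perm_on D u && (u n == n).
  apply/idP/andP => [h|[h un]].
    by split; [apply: subset_trans h sub | rewrite (out_perm h) // !inE eqxx].
  apply/subsetP => x; rewrite !inE => ux; rewrite (subsetP h) ?andbT //.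
  by apply: contraNneq ux => ->; rewrite un.
have [sn|sn] := eqVneq (s n) n.
  rewrite big1 ?addr0.
    by rewrite /gram hs fixD hs sn eqxx cD exprS mulrA.
  move=> i; rewrite inE => /andP[]; rewrite inE => ni iD.
  rewrite /gram fixD permM tpermL ifF //.
  by apply/negP => /andP[_ /eqP e]; rewrite -[RHS]sn in e; rewrite (perm_inj e) eqxx in ni.
rewrite {2}/gram fixD (negPf sn) andbF mulr0 add0r.
have ns : s^-1%g n \in D :\ n.
  rewrite !inE (canF_eq (permKV s)) eq_sym sn /=.
  by rewrite perm_closed //; apply: perm_onV.
rewrite (bigD1 _ ns) /= [X in _ + X]big1; last first.
  move=> i /andP[iD ins].
  rewrite /gram fixD permM tpermL ifF //; apply/negP => /andP[_ /eqP e].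
  by rewrite -e permK eqxx in ins.
rewrite addr0.
set i := s^-1%g n in ns *; have /setD1P[ni iD] := ns.
rewrite /gram hs fixD permM tpermL permKV eqxx andbT.
rewrite perm_onMl ?onD // hs cD.
have h : n \in porbit s i by apply/porbitP; exists 1%N; rewrite expg1 permKV.
rewrite (perm_len_split _ h) 1?eq_sym // !exprS.
have := expf_neq0 (perm_len (tperm n i * s)) d0.
by move: (d%:R ^+ _) (d%:R ^+ _) => u v u0; field; rewrite u0 d0.
Qed.

(** All subsets [D] are taken at once, since the recursion passes to smaller subsets with the same
    [d]. *)
Definition wg_defined d :=
  (0 < d)%N /\ forall D, gconv (wg K D d) (gram K D d) =1 @gdelta K _.

Lemma wg_defined_eventually : exists d0, forall d, (d0 <= d)%N -> wg_defined d.
Proof.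
have /fin_all_exists[d0 h] := @gconv_wg_gram K T.
exists (\max_D d0 D).+1 => d hd; split=> [|D]; first exact: leq_ltn_trans hd.
by apply: h; rewrite (leq_trans _ (ltnW hd)) // leq_bigmax.
Qed.

Section Defined.
Variables (d : nat) (hd : wg_defined d).

Let dn0 : d%:R != 0 :> K.
Proof. by have [d0 _] := hd; rewrite pnatr_eq0 -lt0n. Qed.

(** [gram] is invariant under inversion, and inversion reverses the order of convolution, so [wg]
    composed with inversion is again an inverse of [gram]. *)
Lemma wgV D s : wg K D d s^-1%g = wg K D d s.
Proof.
have [_ /(_ D) h] := hd; apply: (gconv_uniq (f := wg K D d \o invg) _ h s) => {}s.
transitivity (gconv (wg K D d \o invg) (gram K D d \o invg) s).
  by apply: eq_bigr => t _ /=; rewrite gramV.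
by rewrite gconvV gconvC // /gdelta invg_eq1.
Qed.

(** Cutting [wg] off outside the permutations of [D] leaves a convolution inverse, because [gram]
    vanishes off that subgroup; uniqueness then forces equality. *)
Lemma wg_support D s : ~~ perm_on D s -> wg K D d s = 0.
Proof.
have [_ /(_ D) h] := hd => sD.
pose f s := if perm_on D s then wg K D d s else 0.
suff /(gconv_uniq h)/(_ s) -> : gconv f (gram K D d) =1 @gdelta K _.
  by rewrite /f (negPf sD).
move=> t; have [tD|tD] := boolP (perm_on D t).
  rewrite -h; apply: eq_bigr => u _; rewrite /f; case: ifPn => // uD.
  rewrite mul0r /gram ifF ?mulr0 //; apply: contraNF uD => e.
  have := perm_onM tD (perm_onV e).
  by rewrite invMg invgK mulKVg.
rewrite /gdelta (_ : (t == 1%g) = false); last first.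
  by apply: contraNF tD => /eqP ->; apply: perm_on1.
rewrite /gconv big1 // => u _; rewrite /f; case: ifPn => [uD|]; last by rewrite mul0r.
by rewrite /gram perm_onMl ?perm_onV // (negPf tD) mulr0.
Qed.

(** By [gramM_rec], [gram D] is [gram (D :\ n)] times the Jucys-Murphy factor of [n]. Applying this
    factor to [wg D] therefore produces an inverse of [gram (D :\ n)], and inverses are unique. *)
Lemma wg_rec D n s : n \in D ->
  d%:R * wg K D d s + \sum_(i in D :\ n) wg K D d (tperm n i * s)%g =
  wg K (D :\ n) d s.
Proof.
move=> nD; have [_ h] := hd.
pose f s := d%:R * wg K D d s + \sum_(i in D :\ n) wg K D d (tperm n i * s)%g.
suff e : gconv f (gram K (D :\ n) d) =1 @gdelta K _.
  exact: (gconv_uniq e (h _)).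
apply: gconvC => t; rewrite -(gconvC (h D)) /gconv /f.
under eq_bigr do rewrite mulrDr mulr_sumr.
rewrite big_split /= exchange_big /=.
have e i : i \in D :\ n ->
    \sum_u gram K (D :\ n) d u * wg K D d (tperm n i * (u^-1 * t))%g =
    \sum_u gram K (D :\ n) d (u * tperm n i)%g * wg K D d (u^-1 * t)%g.
  move=> _; rewrite [RHS](reindex_inj (mulIg (tperm n i))) /=.
  apply: eq_bigr => u _; rewrite -mulgA tperm2 mulg1.
  by rewrite invMg tpermV mulgA.
rewrite (eq_bigr _ e) exchange_big -big_split; apply: eq_bigr => u _ /=.
rewrite -mulr_suml mulrCA mulrA -mulrDl; congr (_ * _).
(* [gramM_rec] multiplies by the transposition on the left, and here it stands on the right; passing
   to inverses exchanges the two. *)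
rewrite -[RHS]gramV (@gramM_rec D d _ n) // gramV; congr (_ + _).
by apply: eq_bigr => i _; rewrite -[LHS]gramV invMg tpermV.
Qed.

End Defined.

(** Scale [wg_rec] by [d ^ e] and let [d] grow. An [i] in the cycle of [n] shortens the permutation
    and survives; any other [i] lengthens it and loses [d ^ 2]. The right-hand side vanishes by
    [wg_support] unless [s] fixes [n]. *)
Lemma wg_limit_rec D n s : n \in D -> perm_on D s ->
  wg_limit K D s = (s n == n)%:R * wg_limit K (D :\ n) s -
    \sum_(i in porbit s n | i != n) wg_limit K D (tperm n i * s)%g.
Proof.
move=> nD sD; have cD : #|D| = #|D :\ n|.+1 by rewrite (cardsD1 n) nD.
have [d0 h0] := wg_defined_eventually.
pose e := (#|D :\ n| + perm_len s)%N.
have lim i : i \in D :\ n -> asymp (fun d => d%:R ^+ e * wg K D d (tperm n i * s)%g)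
    (if i \in porbit s n then wg_limit K D (tperm n i * s)%g else 0).
  rewrite !inE => /andP[ni iD]; case: ifPn => h.
    have -> : e = (#|D| + perm_len (tperm n i * s)%g)%N.
      rewrite /e cD (@perm_len_split _ s n i) 1?addnS 1?eq_sym //.
      by rewrite porbit_sym.
    exact: asymp_wg_limit.
  rewrite -[0](mul0r (wg_limit K D (tperm n i * s)%g)).
  apply: (@eq_asymp _ 1%N (fun d => d%:R ^- 2 *
      (d%:R ^+ (#|D| + perm_len (tperm n i * s)%g) * wg K D d (tperm n i * s)%g))).
    move=> d d1; rewrite perm_len_merge 1?porbit_sym // cD.
    rewrite (_ : (_ + _)%N = 2 + e)%N; last by rewrite /e addSn addnS.
    by rewrite [_ ^+ (2 + e)]exprD -mulrA mulKf // expf_neq0 // pnatr_eq0 -lt0n.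
  by apply: asympM; [exact: asympVX | exact: asymp_wg_limit].
have A1 := asymp_wg_limit K D s.
have A2 : asymp (fun d => d%:R ^+ e * wg K (D :\ n) d s)
    ((s n == n)%:R * wg_limit K (D :\ n) s).
  case: eqP => sn; first by rewrite mul1r; exact: asymp_wg_limit.
  rewrite mul0r; apply: (@eq_asymp _ d0 (fun=> 0)) (asymp_cst 0) => d hd.
  rewrite (wg_support (h0 _ hd)) ?mulr0 //; apply/negP => h.
  by apply: sn; rewrite (out_perm h) // !inE eqxx.
have A3 := asympD A2 (asympN (asymp_sum (index_enum T) lim)).
have -> : \sum_(i in porbit s n | i != n) wg_limit K D (tperm n i * s)%g =
    \sum_(i in D :\ n) (if i \in porbit s n then wg_limit K D (tperm n i * s)%g else 0).
  rewrite -big_mkcondr; apply: eq_bigl => i; rewrite !inE andbC.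
  case: (boolP (i \in porbit s n)) => [h|_]; rewrite ?andbF // !andbT.
  by rewrite (subsetP (porbit_sub sD nD)) ?andbT.
apply: asymp_inj A1 _; apply: (@eq_asymp _ d0) A3 => d hd.
rewrite -mulr_sumr -mulrBr -(wg_rec (h0 _ hd) _ nD) addrK mulrA -exprSr.
by rewrite cD addSn.
Qed.

(** Induction on [#|D|] and then on the length of [s]: at the identity the recursion removes a point
    of [D]; otherwise, at a point moved by [s], it is the recursion [moebius_split]. *)
Lemma wg_limitE D s : perm_on D s -> wg_limit K D s = moebius K s.
Proof.
elim: {D}#|D| {-2}D (erefl #|D|) s => [D /cards0_eq ->|m IHm D cD] s.
  move=> /perm_on_1 ->; rewrite moebius1.
  have [d0 h0] := wg_defined_eventually.
  apply: (asymp_inj (asymp_wg_limit K set0 1%g)).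
  apply: (@eq_asymp _ d0 (fun=> 1)) (asymp_cst 1) => d hd.
  have [_ /(_ set0 1%g)] := h0 _ hd; rewrite /gdelta eqxx /gconv => h.
  rewrite cards0 perm_len1 mul1r -[LHS]/(true%:R : K) -h (bigD1 1%g) //= big1 ?addr0.
    by rewrite /gram invg1 mulg1 perm_on1 cards0 perm_len1 divr1 mulr1.
  move=> t t1; rewrite (wg_support (h0 _ hd)) ?mul0r //.
  by apply: contraNN t1 => /perm_on_1 ->.
elim: {s}(perm_len s) {-2}s (erefl (perm_len s)) => [|l IHl] s sl sD.
  have -> : s = 1%g by apply/eqP/negPn/negP => /perm_len_gt0; rewrite sl.
  have [n nD] : exists n, n \in D by apply/set0Pn; rewrite -card_gt0 cD.
  rewrite (wg_limit_rec nD (perm_on1 _)) perm1 eqxx mul1r IHm ?perm_on1 //; last first.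
    by move: cD; rewrite (cardsD1 n) nD => -[].
  rewrite big1 ?subr0 // => i /andP[].
  by rewrite porbit_fix ?perm1 // inE => /eqP ->; rewrite eqxx.
have [n sn] : exists n, s n != n.
  apply/existsP; rewrite -negb_forall; apply: contra_eqN sl => /forallP h.
  have -> : s = 1%g by apply/permP => x; rewrite perm1; apply/eqP.
  by rewrite perm_len1.
have nD : n \in D by apply: (subsetP sD).
rewrite (wg_limit_rec nD sD) (negPf sn) mul0r add0r (moebius_split _ sn).
congr (- _); apply: eq_bigr => i /andP[ni ii].
have iD := subsetP (porbit_sub sD nD) _ ni.
apply: IHl.
  by apply/eqP; rewrite -eqSS -sl (@perm_len_split _ s n i) // 1?porbit_sym // eq_sym.
apply: perm_onM => //; apply/subsetP => x; rewrite inE; apply: contraR => xD.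
by rewrite tpermD //; apply: contraNneq xD => <-.
Qed.

Lemma asymp_wg D s : perm_on D s ->
  asymp (fun d => d%:R ^+ (#|D| + perm_len s) * wg K D d s) (moebius K s).
Proof. by move=> h; rewrite -(wg_limitE h); apply: asymp_wg_limit. Qed.

End WeingartenRecursion.

(** * Centered sums of Weingarten functions *)

Section CenteredWeingarten.
Variables (K : archiRealFieldType) (T : finType).
Implicit Types (s t : {perm T}) (D A B : {set T}) (x y n : T) (d : nat).

(** This is the alternating sum [Delta_A]: [B] is the set of atoms from which [-1/d] is taken, and
    the Weingarten function lives on the remaining points. *)
Definition centered_wg A d s : K :=
  \sum_(B : {set T} | B \subset A) (- d%:R^-1) ^+ #|B| * wg K (~: B) d s.

(* Pairing [B] with [a |: B], each pair is an instance of [wg_rec] at [a]. *)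
Lemma centered_wg_rec A d a s : wg_defined K T d -> a \in A ->
  centered_wg A d s =
  - d%:R^-1 * \sum_(i | i != a) centered_wg (A :\ a :\ i) d (tperm a i * s)%g.
Proof.
move=> hd aA; have dn0 : d%:R != 0 :> K by rewrite pnatr_eq0 -lt0n; case: hd.
rewrite /centered_wg (bigID (fun B : {set T} => a \in B)) /=.
rewrite (reindex_onto (fun B => a |: B) (fun B => B :\ a)) /=; last first.
  by move=> B /andP[_ aB]; rewrite setD1K.
rewrite (eq_bigl (fun B => (B \subset A) && (a \notin B))); last first.
  move=> B; rewrite setU11 andbT subUset sub1set aA /=; congr (_ && _).
  apply/eqP/idP => [<-|aB]; first by rewrite !inE eqxx.
  by rewrite setU1K.
have step B : (B \subset A) && (a \notin B) ->
    (- d%:R^-1) ^+ #|a |: B| * wg K (~: (a |: B)) d s +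
      (- d%:R^-1) ^+ #|B| * wg K (~: B) d s =
    - d%:R^-1 * \sum_(i | (i != a) && (i \notin B))
       (- d%:R^-1) ^+ #|B| * wg K (~: B) d (tperm a i * s)%g :> K.
  case/andP=> _ aB; rewrite cardsU1 aB add1n setCU.
  have -> : ~: [set a] :&: ~: B = ~: B :\ a by rewrite setDE setIC.
  rewrite -(wg_rec hd) ?inE // -mulr_sumr.
  rewrite [in RHS](eq_bigl (fun i => i \in ~: B :\ a)); last by move=> i; rewrite !inE.
  set S := \sum_(i in _) _; rewrite exprS mulrDr.
  set w := wg K _ _ _; set u := (- _) ^+ _.
  by field.
rewrite -big_split (eq_bigr _ step) -mulr_sumr; congr (_ * _).
rewrite (exchange_big_dep (fun i => i != a)) /=; last by move=> B i _ /andP[].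
apply: eq_bigr => i ia; apply: eq_bigl => B.
by rewrite !subsetD1 ia.
Qed.

End CenteredWeingarten.

(** * The constants [rho] and the leading term of the centered sums *)

Section Rho.
Variable K : realType.

(** The odd case of [rho] with the cycle sum as a free argument [f], since the recursion shifts it
    by [4]. *)
Definition rho_odd (k : nat) (f : K) : K :=
  (dfact (2 * k)%N)%:R *
    \sum_(0 <= l < k.+1)
      (dfact (2 * k - 2 * l - 1)%N)%:R / (dfact (2 * k - 2 * l)%N)%:R *
      ((4 * l)%N%:R + f).

Lemma dfact_gt0 n : (0 < dfact n)%N.
Proof.
elim/ltn_ind: n => -[|[|n]] IH //=.
by rewrite muln_gt0 /= IH.
Qed.

Lemma dfact_neq0 n : (dfact n)%:R != 0 :> K.
Proof. by rewrite pnatr_eq0 -lt0n dfact_gt0. Qed.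

Lemma dfactSS n : dfact n.+2 = (n.+2 * dfact n)%N.
Proof. by []. Qed.

Lemma dfact_odd k : dfact (2 * k.+1 - 1) = ((2 * k.+1 - 1) * dfact (2 * k - 1))%N.
Proof.
case: k => // k; rewrite (_ : 2 * k.+2 - 1 = (2 * k.+1 - 1).+2)%N; last by lia.
by rewrite dfactSS.
Qed.

Lemma rho_odd0 f : rho_odd 0 f = f.
Proof. by rewrite /rho_odd big_nat1 !muln0 /= divr1 add0r !mul1r. Qed.

(** Split off the term [l = 0]; shifting the index in the others turns [4 * l] into [4 * l + 4]. *)
Lemma rho_oddS k f :
  rho_odd k.+1 f = (dfact (2 * k).+1)%:R * f + (2 * k.+1)%:R * rho_odd k (f + 4).
Proof.
rewrite /rho_odd big_nat_recl // mulrDr !muln0 subn0 add0r; congr (_ + _).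
  rewrite (_ : (2 * k.+1 - 1)%N = (2 * k).+1); last by lia.
  by rewrite mulrA mulrCA mulfV ?dfact_neq0 // mulr1.
rewrite {1}(_ : (2 * k.+1)%N = (2 * k).+2); last by lia.
rewrite dfactSS natrM -(_ : (2 * k.+1)%N = (2 * k).+2); last by lia.
rewrite -mulrA; congr (_ * (_ * _)); apply: eq_bigr => l _.
rewrite (_ : (2 * k.+1 - 2 * l.+1)%N = (2 * k - 2 * l)%N); last by lia.
by congr (_ * _); rewrite mulnS natrD; ring.
Qed.

Definition fixes q (A : {set 'I_q}) (s : 'S_q) := forall x, x \in A -> s x = x.

(* The sum of [(4 C ^ 2 - 2 C) / (C + 1)] over the cycles avoiding [A], spread
   over the points of these cycles. *)
Definition excess q (A : {set 'I_q}) (s : 'S_q) : K :=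
  \sum_(x | x \notin A) (4 * #|porbit s x|%:R - 2) / (#|porbit s x|%:R + 1).

(** A cycle of size [C] has [C] points, each carrying [(4 C - 2) / (C + 1)]. A cycle that meets [A]
    is a single point of [A], since [A] is fixed, and drops out on both sides. *)
Lemma rhoE q (A : {set 'I_q}) (s : 'S_q) : fixes A s ->
  rho K A s = if odd #|A| then rho_odd (#|A|./2) (excess A s)
              else (dfact (2 * (#|A|)./2 - 1)%N)%:R.
Proof.
move=> sA; rewrite /rho; case: ifP => // _.
rewrite /rho_odd; congr (_ * _); apply: eq_bigr => l _; congr (_ * (_ + _)).
rewrite /excess (partition_big (porbit s) (mem (porbits s))) /=; last first.
  by move=> x _; apply: imset_f.
rewrite big_mkcondr; apply: eq_bigr => c /imsetP[x _ ->].
case: ifPn => [dis|].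
  rewrite (eq_bigl (mem (porbit s x))); last first.
    move=> y /=; rewrite eq_porbit_mem andb_idl // => yx.
    by rewrite (disjointFr dis yx).
  rewrite (eq_bigr (fun=> (4 * #|porbit s x|%:R - 2) / (#|porbit s x|%:R + 1))).
    rewrite big_const iter_addr addr0 -[RHS]mulr_natr.
    set C := #|_|%:R; rewrite (_ : 4 * C ^+ 2 - 2 * C = (4 * C - 2) * C); last by ring.
    by rewrite mulrAC.
  by move=> y /=; rewrite -eq_porbit_mem => /eqP ->.
rewrite disjoint_subset => /subsetPn[y yx]; rewrite inE negbK => yA.
rewrite big1 // => z /andP[zA]; rewrite eq_porbit_mem => zx.
have : z \in porbit s y by move: yx zx; rewrite -!eq_porbit_mem => /eqP -> .
by rewrite porbit_fix ?sA // inE => /eqP zy; rewrite zy yA in zA.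
Qed.


Lemma fixes_tperm_mul q (A : {set 'I_q}) (s : 'S_q) a i : fixes A s ->
  fixes (A :\ a :\ i) (tperm a i * s)%g.
Proof.
move=> sA x; rewrite !inE => /and3P[xi xa xA].
by rewrite permM tpermD 1?eq_sym // sA.
Qed.

(** [a] and [i] leave the displayed set and form a 2-cycle; each of its two points carries
    [(4 * 2 - 2) / (2 + 1) = 2]. *)
Lemma excess_merge q (A : {set 'I_q}) (s : 'S_q) a i : fixes A s ->
  a \in A -> i \in A :\ a ->
  excess (A :\ a :\ i) (tperm a i * s)%g = excess A s + 4.
Proof.
move=> sA aA; rewrite !inE => /andP[ia iA]; set s1 := (_ * s)%g.
have ai : a != i by rewrite eq_sym.
have [] := porbit_merge_expg (sA _ aA) ai; rewrite -/s1 [porbit s i]porbit_fix ?sA //.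
rewrite cards1 => yk ca.
have ci : porbit s1 i = porbit s1 a.
  by apply/eqP; rewrite eq_porbit_mem yk mem_porbit.
rewrite /excess (bigD1 a) ?inE ?eqxx ?andbF //=.
rewrite (bigD1 i) ?inE ?eqxx ?ia //= addrA ci ca addrC; congr (_ + _).
  apply: eq_big => [x|x xA].
    rewrite !inE; have [->|_] := eqVneq x a; first by rewrite aA /= andbF.
    by have [->|_] := eqVneq x i; rewrite ?iA /= ?andbF // !andbT.
  have {}xA : x \notin A.
    by move: xA; rewrite !inE !negb_and !negbK => /andP[/andP[+ xa] xi];
       rewrite (negPf xa) (negPf xi).
  rewrite porbit_tperm_mul_notin // porbit_sym porbit_fix ?sA // inE.
    by apply: contraNneq xA => ->.
  by apply: contraNneq xA => ->.
by field.
Qed.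

Lemma moebius_merge_fixed q (s : 'S_q) a i : s a = a -> s i = i -> a != i ->
  moebius K (tperm a i * s)%g = - moebius K s.
Proof.
move=> sa si ai; rewrite moebius_merge // porbit_fix // cards1.
by rewrite (_ : (4 * 1%:R - 2) / (1%:R + 1) = 1) ?mulN1r //; field.
Qed.

(** The atom [a] is paired with one of the [#|A| - 1] others, all with the same contribution; this
    is the recursion of the odd double factorial. *)
Lemma rho_even_rec q (A : {set 'I_q}) (s : 'S_q) a : fixes A s -> a \in A ->
  ~~ odd #|A| ->
  \sum_(i in A :\ a) rho K (A :\ a :\ i) (tperm a i * s)%g *
    moebius K (tperm a i * s)%g = - (rho K A s * moebius K s).
Proof.
move=> sA aA eA; have cA : #|A| = #|A :\ a|.+1 by rewrite (cardsD1 a) aA.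
have [k cA1] : exists k, #|A :\ a| = (2 * k.+1 - 1)%N.
  exists (#|A|./2).-1; move: eA; rewrite cA; move: #|_| => n; lia.
have cA2 : #|A|./2 = k.+1 by rewrite cA cA1; lia.
rewrite (eq_bigr (fun=> (dfact (2 * k - 1))%:R * - moebius K s)) => [|i iA].
  rewrite big_const iter_addr addr0 rhoE // (negPf eA) cA2 dfact_odd natrM -cA1.
  by rewrite mulrN mulNrn -[_ *+ #|_|]mulr_natr; congr (- _); ring.
have /setD1P[ia iAA] := iA; have cA' : #|A :\ a| = #|A :\ a :\ i|.+1.
  by rewrite (cardsD1 i) iA.
rewrite moebius_merge_fixed ?sA // 1?eq_sym // rhoE; last exact: fixes_tperm_mul.
have -> : #|A :\ a :\ i| = (2 * k)%N by move: cA'; rewrite cA1; move: #|_| => n; lia.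
by rewrite mul2n odd_double /= doubleK mul2n.
Qed.

(** A partner [i] outside [A] leaves an even number of atoms and carries the Catalan ratio of its
    cycle, which sums to [excess]; the [2 * k] partners in [A] each raise [excess] by [4]. The total
    is [rho_oddS]. *)
Lemma rho_odd_rec q (A : {set 'I_q}) (s : 'S_q) a : fixes A s -> a \in A ->
  odd #|A| ->
  \sum_(i | i != a) rho K (A :\ a :\ i) (tperm a i * s)%g *
    moebius K (tperm a i * s)%g = - (rho K A s * moebius K s).
Proof.
move=> sA aA oA; have cA : #|A| = #|A :\ a|.+1 by rewrite (cardsD1 a) aA.
have [k cA1] : exists k, #|A :\ a| = (2 * k)%N.
  exists (#|A|./2); move: oA; rewrite cA; move: #|_| => n; lia.
have cA2 : #|A|./2 = k by rewrite cA cA1; lia.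
have out : \sum_(i | (i != a) && (i \notin A)) rho K (A :\ a :\ i) (tperm a i * s)%g *
    moebius K (tperm a i * s)%g = - ((dfact (2 * k - 1))%:R * excess A s * moebius K s).
  rewrite -mulrA mulrC /excess mulr_suml mulr_suml -sumrN.
  apply: eq_big => [i|i /andP[ia iA]].
    by case: eqVneq => // ->; rewrite aA.
  rewrite (_ : A :\ a :\ i = A :\ a); last first.
    by apply/setP => x; rewrite !inE; have [->|] := eqVneq x i; rewrite ?(negPf iA) ?andbF.
  rewrite rhoE; last first.
    by move=> x; rewrite !inE => /andP[xa xA]; rewrite permM tpermD ?sA // 1?eq_sym //;
      apply: contraNneq iA => <-.
  rewrite cA1 mul2n odd_double doubleK -mul2n moebius_merge ?sA // 1?eq_sym //.
  by rewrite mulNr mulrN mulrC.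
have inn : \sum_(i | (i != a) && (i \in A)) rho K (A :\ a :\ i) (tperm a i * s)%g *
    moebius K (tperm a i * s)%g =
    - ((2 * k)%:R * rho_odd k.-1 (excess A s + 4) * moebius K s).
  rewrite (eq_bigl (fun i => i \in A :\ a)) => [|i]; last by rewrite !inE.
  rewrite (eq_bigr (fun=> - (rho_odd k.-1 (excess A s + 4) * moebius K s))) => [|i iA].
    by rewrite big_const iter_addr addr0 cA1 mulNrn -[_ *+ (2 * k)]mulr_natl mulrA.
  have /setD1P[ia iAA] := iA; have cA' : #|A :\ a| = #|A :\ a :\ i|.+1.
    by rewrite (cardsD1 i) iA.
  rewrite moebius_merge_fixed ?sA // 1?eq_sym // rhoE; last exact: fixes_tperm_mul.
  rewrite excess_merge // mulrN.
  have k0 : (0 < k)%N by move: cA'; rewrite cA1; lia.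
  have -> : #|A :\ a :\ i| = (2 * k.-1).+1 by move: cA'; rewrite cA1; move: #|_| => n; lia.
  by rewrite mul2n /= odd_double /= uphalf_double.
rewrite (bigID (mem A)) /= inn out rhoE // oA cA2 -opprD -mulrDl.
(* For [k = 0] the meaningless [k.-1] is multiplied by zero. *)
congr (- (_ * _)); case: k {cA1 cA2 inn out} => [|k].
  by rewrite muln0 mul0r add0r rho_odd0 /= mul1r.
by rewrite rho_oddS addrC; congr (_%:R * _ + _); rewrite mulnS.
Qed.

(** Induction on [#|A|] by [centered_wg_rec]: the factor [1 / d] leaves the power [E.-1] for each
    term, whose permutation is one longer. If [#|A|] is odd, every [i] contributes; if it is even,
    an [i] outside [A] leaves an odd number of atoms and loses [d ^ 2]. The limits add up by
    [rho_odd_rec] and [rho_even_rec]. *)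
Lemma asymp_centered_wg q (A : {set 'I_q}) (s : 'S_q) : fixes A s ->
  asymp (fun d => d%:R ^+ (q + perm_len s + 2 * (#|A|.+1)./2) * centered_wg K A d s)
    (rho K A s * moebius K s).
Proof.
have [n cA] := ubnP #|A|; elim: n A s cA => // n IH A s; rewrite ltnS => cA sA.
have [d0 h0] := wg_defined_eventually K 'I_q.
have [A0|[a aA]] := set_0Vmem A.
  rewrite rhoE // A0 cards0 /= mul1r muln0 addn0.
  have sT : perm_on [set: 'I_q] s by apply/subsetP => x _; rewrite inE.
  have := asymp_wg K sT; rewrite cardsT card_ord.
  apply: (@eq_asymp _ 0%N) => d _; congr (_ * _); rewrite /centered_wg.
  rewrite (eq_bigl (pred1 set0)) ?big_pred1_eq ?cards0 ?mul1r ?setC0 //.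
  by move=> B; rewrite subset0.
pose E := (q + perm_len s + 2 * (#|A|.+1)./2)%N.
have cA1 : #|A| = #|A :\ a|.+1 by rewrite (cardsD1 a) aA.
have lim i : i != a ->
    asymp (fun d => - (d%:R ^+ E.-1 * centered_wg K (A :\ a :\ i) d (tperm a i * s)%g))
    (- if odd #|A| || (i \in A)
       then rho K (A :\ a :\ i) (tperm a i * s)%g * moebius K (tperm a i * s)%g else 0).
  move=> ia; pose Ai := A :\ a :\ i.
  have cAi : (#|A :\ a| = (i \in A) + #|Ai|)%N by rewrite (cardsD1 i) !inE ia.
  have len : perm_len (tperm a i * s)%g = (perm_len s).+1.
    by rewrite perm_len_merge // porbit_sym porbit_fix ?sA // inE.
  have := IH Ai (tperm a i * s)%g _ (@fixes_tperm_mul _ _ _ a i sA).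
  rewrite len => /(_ _); have -> : (#|Ai| < n)%N.
    by move: cA; rewrite cA1 cAi; move: #|Ai| => m; lia.
  move=> /(_ isT) lim; apply: asympN; case: ifPn => h.
    rewrite (_ : E.-1 = q + (perm_len s).+1 + 2 * #|Ai|.+1./2)%N //.
    move: h; rewrite /E cA1 cAi; move: #|Ai| (perm_len s) => m l.
    by case: (i \in A) => /=; lia.
  (* Here the induction hypothesis has two spare powers of [d]. *)
  rewrite -[0](mul0r (rho K Ai (tperm a i * s)%g * moebius K (tperm a i * s)%g)).
  apply: (@eq_asymp _ d0) (asympM (@asympVX K 2 isT) lim) => d hd.
  have dn0 : d%:R != 0 :> K by rewrite pnatr_eq0 -lt0n; case: (h0 _ hd).
  rewrite (_ : q + (perm_len s).+1 + 2 * #|Ai|.+1./2 = 2 + E.-1)%N; last first.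
    move: h; rewrite /E cA1 cAi; move: #|Ai| (perm_len s) => m l.
    by case: (i \in A) => /=; lia.
  by rewrite [_ ^+ (2 + _)]exprD -mulrA mulKf // expf_neq0.
have S := asymp_sum (index_enum 'I_q) lim.
have -> : rho K A s * moebius K s = \sum_(i | i != a)
    (- if odd #|A| || (i \in A)
       then rho K (A :\ a :\ i) (tperm a i * s)%g * moebius K (tperm a i * s)%g else 0).
  rewrite sumrN; have [oA|oA] := boolP (odd #|A|) => /=.
    by rewrite (rho_odd_rec sA aA oA) opprK.
  rewrite -big_mkcondr.
  rewrite (eq_bigl (fun i => i \in A :\ a)) => [|i]; last by rewrite !inE.
  by rewrite (rho_even_rec sA aA oA) opprK.
apply: (@eq_asymp _ d0) S => d hd.
have dn0 : d%:R != 0 :> K by rewrite pnatr_eq0 -lt0n; case: (h0 _ hd).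
rewrite (centered_wg_rec _ (h0 _ hd) aA) sumrN -mulr_sumr -/E.
have -> : E = E.-1.+1 by rewrite /E cA1 /=; lia.
move: (\sum_(i | _) _) => S'.
by rewrite exprS /=; move: (d%:R ^+ E.-1) => e; field.
Qed.

End Rho.

(** * Relative error terms, uniform over all permutations *)

Section Relative.
Variable K : realType.

Lemma rho_odd_gt0 k (f : K) : 0 < f -> 0 < rho_odd k f.
Proof.
elim: k f => [|k IH] f f0; first by rewrite rho_odd0.
by rewrite rho_oddS addr_gt0 // mulr_gt0 ?ltr0n ?dfact_gt0 // IH // addr_gt0.
Qed.

Lemma excess_term_gt0 q (s : 'S_q) x :
  0 < (4 * #|porbit s x|%:R - 2) / (#|porbit s x|%:R + 1) :> K.
Proof.
have : 1 <= #|porbit s x|%:R :> K by rewrite ler1n lt0n card_porbit_neq0.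
by move=> C1; rewrite divr_gt0 //; lra.
Qed.

(** All terms of [rho] are nonnegative, so it vanishes only for one displayed atom and an empty
    cycle sum, that is, when the atom is the only point. *)
Lemma rho_eq0 q (A : {set 'I_q}) (s : 'S_q) : fixes A s -> rho K A s = 0 ->
  exists2 a, a \in A & forall i, i = a.
Proof.
move=> sA; rewrite rhoE //; case: ifPn => [oA|_ /eqP]; last first.
  by rewrite (negPf (dfact_neq0 _ _)).
have e0 : 0 <= excess K A s by apply: sumr_ge0 => x _; rewrite ltW // excess_term_gt0.
case k: (#|A|./2) => [|m]; last first.
  move=> r0; have : 0 < rho_odd m.+1 (excess K A s); last by rewrite r0 ltxx.
  rewrite rho_oddS ltr_wpDl ?mulr_ge0 // mulr_gt0 ?ltr0n // rho_odd_gt0 //.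
  by rewrite ltr_wpDl.
rewrite rho_odd0 => ex0; have /cards1P[a Aa] : #|A| == 1%N.
  by move: oA k; move: #|A| => n; lia.
exists a => [|i]; first by rewrite Aa set11.
apply/eqP/negPn/negP => ia; have iA : i \notin A by rewrite Aa inE.
have : 0 < excess K A s; last by rewrite ex0 ltxx.
rewrite /excess (bigD1 i) //= ltr_wpDr ?excess_term_gt0 //.
by apply: sumr_ge0 => x _; rewrite ltW // excess_term_gt0.
Qed.

Lemma centered_wg_relative q : exists (C : K) (d0 : nat), forall d, (d0 <= d)%N ->
  forall (A : {set 'I_q}) (s : 'S_q), fixes A s ->
  exists2 eps, `|eps| <= C / d%:R &
    centered_wg K A d s =
    d%:R ^- (2 * (#|A|.+1)./2) * rho K A s * wg K setT d s * (1 + eps).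
Proof.
have [D hD] := wg_defined_eventually K 'I_q.
have key (p : {set 'I_q} * 'S_q) : exists Cd : K * nat, fixes p.1 p.2 ->
    forall d, (Cd.2 <= d)%N -> exists2 eps, `|eps| <= Cd.1 / d%:R &
    centered_wg K p.1 d p.2 =
    d%:R ^- (2 * (#|p.1|.+1)./2) * rho K p.1 p.2 * wg K setT d p.2 * (1 + eps).
  case: p => A s /=; have [/forall_inP sA|nsA] := boolP [forall x in A, s x == x]; last first.
    exists (0, 0%N) => sA; case/negP: nsA; apply/forall_inP => x xA.
    by rewrite sA.
  have {}sA : fixes A s by move=> x /sA /eqP.
  (* A relative error requires a nonzero constant. If the constant is zero, then [q = 1] and the sum
     in [centered_wg_rec] has no term, so both sides are exactly zero. *)
  have [r0|r0] := eqVneq (rho K A s) 0.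
    exists (0, D) => _ d hd; exists 0; first by rewrite normr0 mul0r.
    have [a aA ha] := rho_eq0 sA r0; rewrite r0 mulr0 !mul0r.
    rewrite (centered_wg_rec _ (hD _ hd) aA) big1 ?mulr0 // => i.
    by rewrite (ha i) eqxx.
  have sT : perm_on [set: 'I_q] s by apply/subsetP => x _; rewrite inE.
  have := asymp_wg K sT; rewrite cardsT card_ord => G.
  have m0 := moebius_neq0 K s.
  have [d1 h1] := asymp_neq0 m0 G.
  have := asympM (asymp_centered_wg K sA) (asympV (mulf_neq0 r0 m0) (asympM (asymp_cst _) G)).
  rewrite mulfV ?mulf_neq0 // => -[C [d2 h2]].
  exists (C, maxn D (maxn d1 d2)) => _ d /=.
  rewrite !geq_max => /and3P[/hD hd /h1 Gd /h2 {}h2].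
  have dn0 : d%:R != 0 :> K by rewrite pnatr_eq0 -lt0n; case: hd.
  (* [eps] is the quotient of the two scaled sequences, normalized by their limits, minus [1]. *)
  eexists; first exact: h2.
  rewrite addrC subrK exprD.
  move: Gd; rewrite mulf_eq0 negb_or => /andP[].
  have := expf_neq0 (2 * #|A|.+1./2) dn0.
  move: (d%:R ^+ (2 * _)) (d%:R ^+ _) (wg _ _ _ _) (centered_wg _ _ _ _) => x y w c.
  by move=> x0 y0 w0; field; rewrite r0 x0 y0 w0.
have [Cd h] := fin_all_exists key.
(* Only finitely many pairs [(A, s)] occur, so one constant and one threshold serve them all. *)
exists (\sum_p `|(Cd p).1|), (\max_p (Cd p).2) => d hd A s sA.
have [|eps he ->] := h (A, s) sA d; first by rewrite (leq_trans _ hd) ?leq_bigmax.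
exists eps => //; apply: le_trans he _; rewrite ler_wpM2r ?invr_ge0 //.
rewrite (le_trans (ler_norm _)) // (bigD1 (A, s)) //= lerDl.
by apply: sumr_ge0 => p _.
Qed.

End Relative.

(** * Invariant functionals and the Weingarten formula *)

Local Open Scope sesquilinear_scope.

(** Polynomials in the entries and their conjugates. The last constructor closes the class under
    pointwise equality, so that a function can first be brought into a convenient form. *)
Inductive star_poly (C : numClosedFieldType) (d : nat) : ('M[C]_d -> C) -> Prop :=
| star_poly_cst c : star_poly (fun=> c)
| star_poly_entry i j : star_poly (fun M => M i j)
| star_poly_conj f : star_poly f -> star_poly (fun M => (f M)^*)
| star_poly_add f g : star_poly f -> star_poly g -> star_poly (fun M => f M + g M)
| star_poly_mul f g : star_poly f -> star_poly g -> star_poly (fun M => f M * g M)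
| eq_star_poly f g : f =1 g -> star_poly f -> star_poly g.

Section StarPoly.
Variables (C : numClosedFieldType) (d : nat).
Implicit Types f g h : 'M[C]_d -> C.

Lemma star_poly_sum (I : Type) (r : seq I) (P : pred I) (F : I -> 'M[C]_d -> C) :
  (forall i, P i -> star_poly (F i)) ->
  star_poly (fun M => \sum_(i <- r | P i) F i M).
Proof.
move=> hF; elim: r => [|i r IH].
  by apply: eq_star_poly (star_poly_cst _ 0) => M; rewrite big_nil.
case Pi : (P i); last by apply: eq_star_poly IH => M; rewrite big_cons Pi.
by apply: eq_star_poly (star_poly_add (hF _ Pi) IH) => M; rewrite big_cons Pi.
Qed.

Lemma star_poly_prod (I : Type) (r : seq I) (P : pred I) (F : I -> 'M[C]_d -> C) :
  (forall i, P i -> star_poly (F i)) ->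
  star_poly (fun M => \prod_(i <- r | P i) F i M).
Proof.
move=> hF; elim: r => [|i r IH].
  by apply: eq_star_poly (star_poly_cst _ 1) => M; rewrite big_nil.
case Pi : (P i); last by apply: eq_star_poly IH => M; rewrite big_cons Pi.
by apply: eq_star_poly (star_poly_mul (hF _ Pi) IH) => M; rewrite big_cons Pi.
Qed.

Lemma star_poly_mulmx (A : 'M[C]_d) i j : star_poly (fun M => (A *m M) i j).
Proof.
apply: (@eq_star_poly _ _ (fun M => \sum_k A i k * M k j)); first by move=> M; rewrite mxE.
by apply: star_poly_sum => k _; apply: star_poly_mul; constructor.
Qed.

End StarPoly.

(** The Cayley transform of the natural numbers: numerator and denominator are conjugate, so the
    modulus is [1]. *)
Lemma unit_circle_inj (C : numClosedFieldType) :
  exists z : nat -> C, injective z /\ forall n, z n * (z n)^* = 1.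
Proof.
have sq : 'i ^+ 2 = -1 :> C := sqrCi C.
have nz n : (n%:R + 'i) * (n%:R - 'i) != 0 :> C.
  by rewrite mulrC -subr_sqr sq opprK -natrX -[1]/(1%:R) -natrD pnatr_eq0 addn1.
have nz1 n : n%:R + 'i != 0 :> C by move: (nz n); rewrite mulf_eq0 negb_or => /andP[].
have nz2 n : n%:R - 'i != 0 :> C by move: (nz n); rewrite mulf_eq0 negb_or => /andP[].
exists (fun n => (n%:R + 'i) / (n%:R - 'i)); split=> [m n /eqP|n].
  rewrite eqr_div // -subr_eq0.
  have -> : (m%:R + 'i) * (n%:R - 'i) - (n%:R + 'i) * (m%:R - 'i) =
      2 * 'i * (n%:R - m%:R) :> C by ring.
  rewrite !mulf_eq0 pnatr_eq0 /= (negPf (neq0Ci C)) subr_eq0 eqr_nat.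
  by move=> /eqP.
rewrite rmorphM fmorphV /= rmorphB rmorphD /= conjCi conjC_nat opprK.
by field; rewrite nz1 nz2.
Qed.

Lemma horner_inj_nat (C : numClosedFieldType) (p q : {poly C}) (z : nat -> C) :
  injective z -> (forall n, p.[z n] = q.[z n]) -> p = q.
Proof.
move=> zi e; apply/eqP; rewrite -subr_eq0; apply/negPn/negP => pq.
have := max_poly_roots pq (_ : all (root (p - q)) [seq z n | n <- iota 0 (size (p - q))]).
rewrite size_map size_iota map_inj_uniq ?iota_uniq // ltnn => h.
have // : false; apply: h => //; apply/allP => _ /mapP[n _ ->].
by rewrite /root hornerD hornerN e subrr.
Qed.

(** An invariant function is constant on each cycle, hence amounts to an arbitrary function on the
    set of cycles, extended by the default [y0]. *)
Lemma card_perm_invariant (I T : finType) (s : {perm I}) (y0 : T) :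
  #|[set n : {ffun I -> T} | [forall l, n (s l) == n l]]| = (#|T| ^ #|porbits s|)%N.
Proof.
pose phi (f : {ffun {set I} -> T}) := [ffun x => f (porbit s x)] : {ffun I -> T}.
rewrite -[#|T|]/#|{: T}| -(card_pffun_on y0 (mem (porbits s)) (mem T)).
rewrite -(card_in_imset (f := phi)); last first.
  move=> f g /pffun_onP[/supportP f0 _] /pffun_onP[/supportP g0 _] /ffunP e.
  apply/ffunP => c; have [/imsetP[x _ ->]|cs] := boolP (c \in porbits s).
    by have := e x; rewrite !ffunE.
  by rewrite f0 // g0.
apply/eq_card => n; rewrite inE; apply/forallP/imsetP.
  move=> h; have hX i x : n ((s ^+ i)%g x) = n x.
    by elim: i => [|i IH]; rewrite ?perm1 // expgSr permM (eqP (h _)).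
  exists [ffun c => if c \in porbits s
                    then if [pick x in c] is Some x then n x else y0 else y0].
    apply/pffun_onP; split=> //; apply/supportP => c /negPf cs.
    by rewrite ffunE cs.
  apply/ffunP => x; rewrite !ffunE imset_f //; case: pickP => [y|/(_ x)].
    by move=> /porbitP[i ->]; rewrite hX.
  by rewrite porbit_id.
case=> f _ -> l; rewrite !ffunE; apply/eqP; congr (f _); apply/eqP.
by rewrite eq_porbit_mem -[s l]/((s ^+ 1)%g l) mem_porbit.
Qed.

(** * Mixed moments of an abstract left-invariant mean *)

Section InvariantFunctional.
Variables (C : numClosedFieldType) (d : nat) (E : ('M[C]_d -> C) -> C).
Hypothesis E_cst : forall c, E (fun=> c) = c.
Hypothesis E_add : forall f g, star_poly f -> star_poly g ->
  E (fun M => f M + g M) = E f + E g.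
Hypothesis E_scale : forall c f, star_poly f -> E (fun M => c * f M) = c * E f.
Hypothesis E_left : forall (U : 'M[C]_d) f, U \is unitarymx -> star_poly f ->
  E (fun M => f (U *m M)) = E f.
Hypothesis eq_E : forall f g, (forall M : 'M[C]_d, M \is unitarymx -> f M = g M) -> E f = E g.

Lemma E_sum (I : Type) (r : seq I) (P : pred I) (F : I -> 'M[C]_d -> C) :
  (forall i, P i -> star_poly (F i)) ->
  E (fun M => \sum_(i <- r | P i) F i M) = \sum_(i <- r | P i) E (F i).
Proof.
move=> hF; elim: r => [|i r IH].
  rewrite big_nil -[RHS](E_cst 0); apply: eq_E => M _; exact: big_nil.
rewrite big_cons; case Pi : (P i); last first.
  by rewrite -IH; apply: eq_E => M _; rewrite big_cons Pi.
rewrite -IH -E_add; [|exact: hF|exact: star_poly_sum].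
by apply: eq_E => M _; rewrite big_cons Pi.
Qed.

(** Expand one affine factor at a time and absorb its two parts into [h]. *)
Lemma E_prod_poly (I : Type) (r : seq I) (P : pred I) (f g : I -> 'M[C]_d -> C) h :
  (forall i, star_poly (f i)) -> (forall i, star_poly (g i)) -> star_poly h ->
  exists p : {poly C}, forall z,
    E (fun M => h M * \prod_(i <- r | P i) (f i M + z * g i M)) = p.[z].
Proof.
move=> hf hg; elim: r h => [|i r IH] h hh.
  by exists (E h)%:P => z; rewrite hornerC; apply: eq_E => M _; rewrite big_nil mulr1.
case Pi : (P i); last first.
  by have [p hp] := IH _ hh; exists p => z; rewrite -hp;
    apply: eq_E => M _; rewrite big_cons Pi.
have [p hp] := IH _ (star_poly_mul hh (hf i)).
have [p' hp'] := IH _ (star_poly_mul hh (hg i)).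
exists (p + 'X * p') => z; rewrite hornerD hornerM hornerX -hp -hp'.
have pr : star_poly (fun M => \prod_(j <- r | P j) (f j M + z * g j M)).
  apply: star_poly_prod => j _; apply: star_poly_add => //.
  by apply: star_poly_mul => //; constructor.
rewrite -E_scale; last by do 2?[apply: star_poly_mul => //].
rewrite -E_add.
- by apply: eq_E => M _; rewrite big_cons Pi; ring.
- by do 2?[apply: star_poly_mul => //].
apply: star_poly_mul; first by constructor.
by do 2?[apply: star_poly_mul => //].
Qed.

Variables (I : finType) (D : {set I}) (k k' : I -> 'I_d).
Implicit Types (X Y Z A B : 'M[C]_d) (j n : I -> 'I_d).

(** The multipliers [Y] and [Z] are carried along so that [intertwines] is closed under products. *)
Definition twisted_moment Y Z j n : C :=
  E (fun M => \prod_(l in D) ((Y *m M) (j l) (k l) * ((Z *m M) (n l) (k' l))^*)).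

(* For [X] unitary this is the invariance of [E]. Being polynomial in [X] (the
   conjugate of [X^t*] is [X^T]) and multiplicative in [X], it extends to all
   matrices: from the unit circle to all diagonal matrices, by the spectral
   theorem to Hermitian ones, and from the line [H + t *: H'], with [t] a natural
   number, to [H + 'i *: H']. *)
Definition intertwines X := forall Y Z j n,
  twisted_moment (Y *m X) Z j n = twisted_moment Y (Z *m X^t*) j n.

Lemma intertwines_mul X X' : intertwines X -> intertwines X' ->
  intertwines (X *m X').
Proof.
move=> hX hX' Y Z j n; rewrite mulmxA hX' hX; congr (twisted_moment _ _ _ _).
by rewrite trmx_mul map_mxM mulmxA.
Qed.

Lemma intertwines_unitary X : X \is unitarymx -> intertwines X.
Proof.
(* Replacing [M] by [X *m M] on the right-hand side cancels [X^t*] against [X]. *)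
move=> Xu Y Z j n; rewrite /twisted_moment -[RHS](E_left Xu).
  apply: eq_E => M _; apply: eq_bigr => l _; rewrite !mulmxA.
  by rewrite mulmxKtV.
apply: star_poly_prod => l _; apply: star_poly_mul; first exact: star_poly_mulmx.
by apply: star_poly_conj; apply: star_poly_mulmx.
Qed.

Lemma intertwines_line A B (z : nat -> C) : injective z ->
  (forall m, intertwines (A + z m *: B)) -> forall c, intertwines (A + c *: B).
Proof.
move=> zi h c Y Z j n.
pose a l M := (Y *m A *m M) (j l) (k l); pose b l M := (Y *m B *m M) (j l) (k l).
pose h1 M := \prod_(l in D) ((Z *m M) (n l) (k' l))^*.
have h1p : star_poly h1.
  by apply: star_poly_prod => l _; apply/star_poly_conj/star_poly_mulmx.
have [p hp] := @E_prod_poly _ (index_enum I) (mem D) a b h1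
  (fun=> star_poly_mulmx _ _ _) (fun=> star_poly_mulmx _ _ _) h1p.
pose a' l M := ((Z *m A^t* *m M) (n l) (k' l))^*.
pose b' l M := ((Z *m B^t* *m M) (n l) (k' l))^*.
pose h2 M := \prod_(l in D) (Y *m M) (j l) (k l).
have h2p : star_poly h2 by apply: star_poly_prod => l _; apply: star_poly_mulmx.
have [p' hp'] := @E_prod_poly _ (index_enum I) (mem D) a' b' h2
  (fun l => star_poly_conj (star_poly_mulmx _ _ _))
  (fun l => star_poly_conj (star_poly_mulmx _ _ _)) h2p.
have e1 x : twisted_moment (Y *m (A + x *: B)) Z j n = p.[x].
  rewrite -hp; apply: eq_E => M _; rewrite mulrC -big_split /=.
  apply: eq_bigr => l _; rewrite /a /b; congr (_ * _).
  by rewrite mulmxDr mulmxDl -scalemxAr -scalemxAl !mxE.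
have e2 x : twisted_moment Y (Z *m (A + x *: B)^t*) j n = p'.[x].
  rewrite -hp'; apply: eq_E => M _; rewrite -big_split /=.
  apply: eq_bigr => l _; rewrite /a' /b'; congr (_ * _).
  have -> : (A + x *: B)^t* = A^t* + x^* *: B^t*.
    by apply/matrixP => u v; rewrite !mxE rmorphD rmorphM.
  rewrite mulmxDr mulmxDl -scalemxAr -scalemxAl mxE [X in _ + X]mxE.
  by rewrite rmorphD /= rmorphM /= conjCK.
rewrite e1 e2; congr (_.[_]); apply: (horner_inj_nat zi) => m.
by rewrite -e1 -e2 h.
Qed.

Definition diag_one i (c : C) : 'M[C]_d := diag_mx (\row_m if m == i then c else 1).

Lemma intertwines_diag_one i c : intertwines (diag_one i c).
Proof.
have [z [zi z1]] := unit_circle_inj C.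
pose A : 'M[C]_d := diag_mx (\row_m if m == i then 0 else 1).
pose B : 'M[C]_d := diag_mx (\row_m if m == i then 1 else 0).
have e x : diag_one i x = A + x *: B.
  apply/matrixP => u v; rewrite !mxE; case: (u == v); rewrite ?mulr0n ?mulr1n ?mulr0 ?addr0 //.
  by case: (u == i); rewrite ?mulr1 ?mulr0 ?add0r ?addr0.
rewrite e; apply: (intertwines_line zi) => m; rewrite -e.
apply: intertwines_unitary; apply/unitarymxP.
rewrite /diag_one tr_diag_mx map_diag_mx mulmx_diag -diag_const_mx; congr diag_mx.
by apply/rowP => u; rewrite !mxE; case: (u == i); rewrite ?z1 // rmorph1 mulr1.
Qed.

Lemma intertwines1 : intertwines 1%:M.
Proof. by apply: intertwines_unitary; apply/unitarymxP; rewrite trmx1 map_mx1 mulmx1. Qed.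

Lemma intertwines_diag (r : 'rV[C]_d) : intertwines (diag_mx r).
Proof.
have h (s : seq 'I_d) : uniq s ->
    intertwines (diag_mx (\row_m if m \in s then r 0 m else 1)).
  elim: s => [_|i s IH /andP[is_ us]].
    rewrite (_ : \row_m _ = const_mx 1) ?diag_const_mx; first exact: intertwines1.
    by apply/rowP => m; rewrite !mxE.
  have := intertwines_mul (intertwines_diag_one i (r 0 i)) (IH us).
  rewrite mulmx_diag; congr (intertwines (diag_mx _)); apply/rowP => m.
  rewrite !mxE in_cons; case: eqVneq => [->|_] /=; last by rewrite mul1r.
  by rewrite (negPf is_) mulr1.
have := h _ (enum_uniq 'I_d); congr (intertwines (diag_mx _)).
by apply/rowP => m; rewrite mxE mem_enum.
Qed.

Lemma intertwines_hermitian X : X^t* = X -> intertwines X.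
Proof.
move=> Xh; have /orthomx_spectralP -> : X \is normalmx by apply/normalmxP; rewrite Xh.
have u := spectral_unitarymx X; apply: intertwines_mul; last exact: intertwines_unitary.
apply: intertwines_mul; last exact: intertwines_diag.
by rewrite invmx_unitary //; apply: intertwines_unitary; rewrite trmxC_unitary.
Qed.

Lemma intertwines_all X : intertwines X.
Proof.
pose H : 'M[C]_d := 2^-1 *: (X + X^t*); pose H' : 'M[C]_d := (2^-1 * - 'i) *: (X - X^t*).
have -> : X = H + 'i *: H'.
  apply/matrixP => u v; rewrite !mxE.
  have -> : 'i * (2^-1 * - 'i * (X u v - (X v u)^*)) =
    - ('i ^+ 2) * (2^-1 * (X u v - (X v u)^*)) :> C by ring.
  by rewrite sqrCi; field.
apply: (@intertwines_line H H' (fun m => m%:R) _ _ 'i) => [m m' /eqP|m].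
  by rewrite eqr_nat => /eqP.
apply: intertwines_hermitian; apply/matrixP => u v; rewrite !mxE.
have e (a b : C) : (2^-1 * (a + b) + m%:R * (2^-1 * - 'i * (a - b)))^* =
    2^-1 * (a^* + b^*) - m%:R * (2^-1 * - 'i * (a^* - b^*)).
  rewrite rmorphD /= !rmorphM /= rmorphD rmorphB /= rmorphN /= conjCi fmorphV.
  by rewrite /= !conjC_nat; ring.
by rewrite e conjCK; ring.
Qed.

Definition moment j n : C :=
  E (fun M => \prod_(l in D) (M (j l) (k l) * (M (n l) (k' l))^*)).

Lemma moment_twist X j n :
  E (fun M => \prod_(l in D) ((X *m M) (j l) (k l) * (M (n l) (k' l))^*)) =
  E (fun M => \prod_(l in D) (M (j l) (k l) * ((X^t* *m M) (n l) (k' l))^*)).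
Proof.
transitivity (twisted_moment (1%:M *m X) 1%:M j n).
  by apply: eq_E => M _; apply: eq_bigr => l _; rewrite !mul1mx.
rewrite intertwines_all; apply: eq_E => M _; apply: eq_bigr => l _.
by rewrite !mul1mx.
Qed.

Variable iota : I -> 'I_d.
Hypothesis iota_inj : injective iota.

(** Maps of [D] into itself, extended by the identity; the bijective ones are exactly the
    permutations with [perm_on D]. *)
Definition self_map : pred {ffun I -> I} :=
  [pred p | p \in family (fun l => [pred m | if l \in D then m \in D else m == l])].

(* [moment_twist] for a matrix [X] whose [iota l]-th column is the [n l]-th unit
   vector; this is where [#|I| <= d] is needed. *)
Lemma moment_expand j n : moment j n =
  \sum_(p : {ffun I -> I} | self_map p)
    [forall l in D, j l == n (p l)]%:R * moment (iota \o p) iota.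
Proof.
pose X : 'M[C]_d := \matrix_(a, b) \sum_(l in D) (a == n l)%:R * (b == iota l)%:R.
have rowX (M : 'M[C]_d) a c : (X *m M) a c = \sum_(l in D) (a == n l)%:R * M (iota l) c.
  rewrite mxE; under eq_bigr do rewrite mxE mulr_suml.
  rewrite exchange_big /=; apply: eq_bigr => l _.
  rewrite (bigD1 (iota l)) //= eqxx mulr1 big1 ?addr0 // => b bl.
  by rewrite (negPf bl) mulr0 mul0r.
have rowXt (M : 'M[C]_d) l c : l \in D -> (X^t* *m M) (iota l) c = M (n l) c.
  move=> lD; rewrite mxE (bigD1 (n l)) //= [X in _ + X]big1; last first.
    move=> a al; rewrite !mxE big1 ?rmorph0 ?mul0r // => m _.
    have [e|ml] := eqVneq l m; first by rewrite -e (negPf al) mul0r.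
    by rewrite (inj_eq iota_inj) (negPf ml) mulr0.
  rewrite addr0 !mxE (bigD1 l) //= !eqxx mulr1 big1 ?addr0 ?rmorph1 ?mul1r //.
  by move=> m /andP[_ ml]; rewrite (inj_eq iota_inj) [l == m]eq_sym (negPf ml) mulr0.
transitivity (E (fun M => \prod_(l in D)
    (M (j l) (k l) * ((X^t* *m M) (iota l) (k' l))^*))).
  by apply: eq_E => M _; apply: eq_bigr => l lD; rewrite rowXt.
rewrite -moment_twist.
pose G (p : {ffun I -> I}) (M : 'M[C]_d) := \prod_(l in D)
  ((j l == n (p l))%:R * (M (iota (p l)) (k l) * (M (iota l) (k' l))^*)) : C.
transitivity (E (fun M => \sum_(p : {ffun I -> I} | self_map p) G p M)).
  apply: eq_E => M _.
  under eq_bigr do rewrite rowX mulr_suml.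
  rewrite big_mkcond /=.
  (* Outside [D] the factor [1] is written as a sum over the single index [m = l], so that
     distributing the product yields exactly the maps in [self_map]. *)
  rewrite (eq_bigr (fun l => \sum_(m | if l \in D then m \in D else m == l)
    (if l \in D then (j l == n m)%:R * (M (iota m) (k l) * (M (iota l) (k' l))^*) else 1))).
    by rewrite bigA_distr_big_dep; apply: eq_bigr => p _; rewrite /G [RHS]big_mkcond.
  move=> l _; case: ifP => lD; last by rewrite big_pred1_eq.
  by apply: eq_bigr => m _; rewrite mulrA.
have monp (p : {ffun I -> I}) : star_poly (fun M : 'M[C]_d => \prod_(l in D)
    (M (iota (p l)) (k l) * (M (iota l) (k' l))^*)).
  apply: star_poly_prod => l _; apply: star_poly_mul; first by constructor.
  by apply: star_poly_conj; constructor.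
have GE (p : {ffun I -> I}) : G p =1 (fun M => [forall l in D, j l == n (p l)]%:R *
    \prod_(l in D) (M (iota (p l)) (k l) * (M (iota l) (k' l))^*)).
  move=> M; rewrite /G big_split /=; congr (_ * _).
  case: forall_inP => [h|/forall_inP].
    by rewrite big1 // => l /h ->.
  rewrite negb_forall_in => /exists_inP[l lD /negPf jl].
  by rewrite (bigD1 l) //= jl mul0r.
rewrite E_sum => [|p _]; last first.
  apply: (eq_star_poly (fun M => esym (GE p M))).
  by apply: star_poly_mul; first by constructor.
apply: eq_bigr => p _; rewrite -[RHS](E_scale _ (monp p)).
by apply: eq_E => M _; exact: GE.
Qed.

(* Doubling the coordinate [iota i] multiplies the moment by [2] on one side and
   by [2 ^ #|p^-1 i|] on the other, so each fiber of [p] over [D] is a singleton. *)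
Lemma moment_iota_eq0 (p : {ffun I -> I}) : self_map p -> ~~ injectiveb p ->
  moment (iota \o p) iota = 0.
Proof.
move=> /familyP pD; apply: contraNeq => m0.
have sur i : i \in D -> exists2 l, l \in D & p l = i.
  move=> iD; have := moment_twist (diag_one (iota i) 2) (iota \o p) iota.
  have -> : (diag_one (iota i) 2)^t* = diag_one (iota i) 2.
    rewrite /diag_one tr_diag_mx map_diag_mx; congr diag_mx; apply/rowP => u.
    by rewrite !mxE; case: ifP => _; rewrite ?rmorph1 ?rmorph_nat.
  have rowd (M : 'M[C]_d) a c : (diag_one (iota i) 2 *m M) a c = (if a == iota i then 2 else 1) * M a c.
    by rewrite mul_diag_mx !mxE.
  have monp : star_poly (fun M : 'M[C]_d => \prod_(l in D)
      (M (iota (p l)) (k l) * (M (iota l) (k' l))^*)).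
    apply: star_poly_prod => l _; apply: star_poly_mul; first by constructor.
    by apply: star_poly_conj; constructor.
  rewrite [X in X = _ -> _](_ : _ = (\prod_(l in D) (if p l == i then 2 else 1)) *
      moment (iota \o p) iota); last first.
    rewrite -(E_scale _ monp); apply: eq_E => M _; rewrite -big_split; apply: eq_bigr => l _ /=.
    by rewrite rowd /= (inj_eq iota_inj) mulrA.
  rewrite [X in _ = X -> _](_ : _ = (\prod_(l in D) (if l == i then 2 else 1)) *
      moment (iota \o p) iota); last first.
    rewrite -(E_scale _ monp); apply: eq_E => M _; rewrite -big_split; apply: eq_bigr => l _ /=.
    rewrite rowd /= (inj_eq iota_inj) rmorphM mulrCA; congr (_ * _).
    by case: ifP => _; rewrite ?rmorph1 ?rmorph_nat.
  move=> /(mulIf m0); rewrite [RHS](bigD1 i) //= eqxx [X in _ = _ * X]big1; last first.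
    by move=> l /andP[_ /negPf ->].
  (* If no point of [D] were mapped to [i], the two products would be [1] and [2]. So [p] maps the
     finite set [D] onto itself and is injective there. *)
  move=> e; suff /exists_inP[l lD /eqP pl] : [exists l in D, p l == i] by exists l.
  apply: contra_eqT e.
  rewrite negb_exists_in => /forall_inP h; rewrite big1 => [|l lD].
    by rewrite mulr1 eq_sym -[1]/(1%:R) eqr_nat.
  by rewrite (negPf (h l lD)).
have im : p @: D = D.
  apply/eqP; rewrite eq_sym eqEcard leq_imset_card andbT.
  by apply/subsetP => i /sur[l lD <-]; apply: imset_f.
have /imset_injP injD : #|p @: D| == #|D| by rewrite im.
apply/injectiveP => x y e; have := pD x; have := pD y; rewrite !inE.
case: ifP => yD; case: ifP => xD.
- by move=> _ _; apply: injD.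
- by rewrite -e => h /eqP e'; rewrite e' xD in h.
- by move=> /eqP e'; rewrite e e' yD.
by move=> /eqP e1 /eqP e2; rewrite -e1 -e2.
Qed.

Definition perm_coef (t : {perm I}) : C := moment (iota \o t) iota.

Lemma moment_perm j n : moment j n =
  \sum_(t : {perm I} | perm_on D t) [forall l in D, j l == n (t l)]%:R * perm_coef t.
Proof.
rewrite moment_expand (bigID (fun p : {ffun I -> I} => injectiveb p)) /=.
rewrite [X in _ + X]big1 ?addr0 => [|p /andP[h1 h2]]; last first.
  by rewrite moment_iota_eq0 ?mulr0.
rewrite (reindex_onto (fun t : {perm I} => pval t) (fun p => insubd (1%g : {perm I}) p)) /=; last first.
  by move=> p /andP[_ pi]; apply: (@insubdK _ _ {perm I}).
apply: eq_big => [t|t _]; last first.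
  congr ((nat_of_bool _)%:R * _); first by apply: eq_forallb_in => l _; rewrite pvalE.
  by apply: eq_E => M _; apply: eq_bigr => l _; rewrite /= pvalE.
have -> : insubd (1%g : {perm I}) (pval t) = t by apply: val_inj; rewrite insubdK //; apply: valP.
rewrite eqxx andbT; have -> : injectiveb (pval t) by apply: (valP t).
rewrite andbT; apply/familyP/idP => [h|h l].
  apply/subsetP => x; rewrite inE; apply: contraR => xD.
  by have := h x; rewrite !inE (negPf xD) pvalE.
by rewrite !inE pvalE; case: ifPn => lD; [rewrite perm_closed | rewrite (out_perm h)].
Qed.

Lemma perm_on_reindex (M : comPzSemiRingType) (r : {perm I}) (F : I -> M) :
  perm_on D r -> \prod_(l in D) F l = \prod_(l in D) F (r l).
Proof.
by move=> rD; rewrite (reindex_inj (@perm_inj _ r)); apply: eq_bigl => l;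
   rewrite perm_closed.
Qed.

(* Orthogonality of the columns; comparing with [moment_perm] shows that
   [perm_coef] convolved with [gram] is the matching indicator of [k] and [k']. *)
Lemma moment_contract (r : {perm I}) : perm_on D r ->
  \sum_(n : {ffun I -> 'I_d}) moment (n \o r) n =
  d%:R ^+ #|~: D| * [forall l in D, k l == k' (r l)]%:R.
Proof.
move=> rD; rewrite -[RHS]E_cst.
have mon (n : {ffun I -> 'I_d}) : star_poly (fun M : 'M[C]_d => \prod_(l in D)
    (M (n (r l)) (k l) * (M (n l) (k' l))^*)).
  apply: star_poly_prod => l _; apply: star_poly_mul; first by constructor.
  by apply: star_poly_conj; constructor.
rewrite -(E_sum _ (fun (u : {ffun I -> 'I_d}) _ => mon u)); apply: eq_E => M Mu.
transitivity (\sum_(n : {ffun I -> 'I_d}) \prod_l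
    (if l \in D then M (n l) (k l) * (M (n l) (k' (r l)))^* else 1)).
  rewrite (reindex (fun n : {ffun I -> 'I_d} => [ffun l => n (r^-1%g l)])) /=; last first.
    exists (fun n : {ffun I -> 'I_d} => [ffun l => n (r l)]) => n _; apply/ffunP => l;
      by rewrite !ffunE ?permK ?permKV.
  apply: eq_bigr => n _; rewrite -big_mkcond !big_split /=; congr (_ * _).
    by apply: eq_bigr => l _; rewrite ffunE permK.
  rewrite (perm_on_reindex _ rD); apply: eq_bigr => l _.
  by rewrite ffunE permK.
rewrite -(bigA_distr_bigA (fun l a => if l \in D then M a (k l) * (M a (k' (r l)))^* else 1)).
rewrite (bigID (mem D)) /= mulrC; congr (_ * _).
  rewrite (eq_bigr (fun=> d%:R)) => [|l /negPf ->]; last first.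
    by rewrite sumr_const card_ord.
  by rewrite prodr_const; congr (_ ^+ _); apply: eq_card => l; rewrite !inE.
have orth a b : \sum_c M c a * (M c b)^* = (a == b)%:R.
  have /unitarymxP : M^t* \is unitarymx by rewrite trmxC_unitary.
  rewrite -map_trmx trmxK map_mxCK => /matrixP /(_ b a); rewrite !mxE eq_sym => <-.
  by apply: eq_bigr => c _; rewrite !mxE mulrC.
under eq_bigr => l lD do (under eq_bigr do rewrite lD); rewrite -/(index_enum _).
under eq_bigr do rewrite orth.
case: forall_inP => [h|/forall_inP].
  by rewrite big1 // => l /h ->.
rewrite negb_forall_in => /exists_inP[l lD /negPf jl].
by rewrite (bigD1 l) //= jl mul0r.
Qed.

(** Convolving the contracted identity with the inverse [W] of the Gram function recovers the
    coefficients [perm_coef], and these determine all moments. *)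
Lemma weingarten_formula (W : {perm I} -> C) j n : (0 < d)%N ->
  gconv (fun s => if perm_on D s then d%:R ^+ #|D| / d%:R ^+ perm_len s else 0) W
    =1 @gdelta C _ ->
  moment j n = \sum_(t : {perm I} | perm_on D t) \sum_(s : {perm I} | perm_on D s)
    [forall l in D, j l == n (t l)]%:R * [forall l in D, k l == k' (s l)]%:R *
    W (s^-1 * t)%g.
Proof.
move=> d0 GW; set g := (fun s => _) in GW.
have dn0 : d%:R != 0 :> C by rewrite pnatr_eq0 -lt0n.
pose c (t : {perm I}) := if perm_on D t then perm_coef t else 0.
pose dl (s : {perm I}) : C := if perm_on D s then [forall l in D, k l == k' (s l)]%:R else 0.
have cg : gconv c g =1 dl.
  move=> r; rewrite /dl; case: ifPn => rD; last first.
    rewrite /gconv big1 // => t _; rewrite /c /g; case: ifP => tD; last by rewrite mul0r.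
    by rewrite perm_onMl ?perm_onV // (negPf rD) mulr0.
  apply: (mulfI (expf_neq0 #|~: D| dn0)); rewrite -(moment_contract rD).
  rewrite /gconv mulr_sumr; under [RHS]eq_bigr do rewrite moment_perm.
  rewrite exchange_big /= [RHS]big_mkcond /=; apply: eq_bigr => t _.
  rewrite /c; case: ifP => tD; last by rewrite mul0r mulr0.
  rewrite -mulr_suml mulrCA mulrC; congr (_ * _).
  (* On [D] the condition says that [u] is invariant under [t^-1 * r]; outside [D] both permutations
     fix every point, so it can be required everywhere and counted by cycles. *)
  have inv (u : {ffun I -> 'I_d}) : [forall l in D, (u \o r) l == u (t l)] =
      [forall l, u ((t^-1 * r)%g l) == u l].
    apply/forall_inP/forallP => [h l|h l lD]; last first.
      by have := h (t l); rewrite permM permK.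
    rewrite permM; have [lD|lD] := boolP (t^-1%g l \in D).
      by have := h _ lD; rewrite /= permKV.
    by rewrite (out_perm rD) // -{2}[l](permKV t) (out_perm tD).
  under [RHS]eq_bigr do rewrite inv.
  rewrite -natr_sum -[X in _ = X%:R](_ : #|[set u : {ffun I -> 'I_d} |
      [forall l, u ((t^-1 * r)%g l) == u l]]| = _); last first.
    by rewrite -sum1dep_card [LHS]big_mkcond; apply: eq_bigr => u _; case: [forall l, _].
  rewrite (card_perm_invariant _ (Ordinal d0)) card_ord natrX.
  rewrite /g perm_onMl ?perm_onV // rD mulrA -exprD.
  rewrite -(_ : (#|porbits (t^-1 * r)%g| + perm_len (t^-1 * r)%g = #|~: D| + #|D|)%N).
    by rewrite exprD mulfK // expf_neq0.
  by rewrite addnC perm_lenK addnC cardsC.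
have cW t : c t = gconv dl W t.
  transitivity (gconv c (@gdelta C _) t).
    rewrite /gconv (bigD1 t) //= big1 => [|u ut]; first by rewrite /gdelta mulVg eqxx mulr1 addr0.
    by rewrite /gdelta -eq_mulVg1 (negPf ut) mulr0.
  transitivity (gconv c (gconv g W) t); first by apply: eq_bigr => u _; rewrite GW.
  by rewrite gconvA; apply: eq_bigr => u _; rewrite cg.
rewrite moment_perm; apply: eq_bigr => t tD.
have -> : perm_coef t = c t by rewrite /c tD.
rewrite cW /gconv mulr_sumr [RHS]big_mkcond; apply: eq_bigr => s _.
by rewrite /dl; case: ifP => _; [rewrite mulrA | rewrite mul0r mulr0].
Qed.

End InvariantFunctional.

(** * Haar expectations of polynomials in the entries *)

From mathcomp Require Import complex.
From mathcomp Require Import all_classical all_reals all_analysis.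
From mathcomp Require Import measurable_realfun.

Import numFieldNormedType.Exports.
Local Open Scope classical_set_scope.
Local Open Scope ring_scope.
Local Open Scope complex_scope.

Lemma isometry_continuous (F : numFieldType) (f : F -> F) :
  (forall x y, `|f x - f y| = `|x - y|) -> continuous f.
Proof.
move=> fi z s /= /nbhs_ballP[e e0 es]; apply/nbhs_ballP; exists e => // y zy.
by apply: es; move: zy; rewrite /ball /= fi.
Qed.

Section HaarExpectation.
Variables (K : realType) (d : nat).

Lemma star_poly_continuous (f : 'M[K[i]]_d -> K[i]) : star_poly f ->
  continuous (f : 'M[K[i] : numFieldType]_d -> (K[i] : numFieldType)).
Proof.
elim=> {f} [c|i j|f _ hf|f g _ hf _ hg|f g _ hf _ hg|f g fg _ hf].
- exact: cst_continuous.
- exact: coord_continuous.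
- by move=> M; apply: (continuous_comp (hf M)); apply: (@isometry_continuous (K[i] : numFieldType)) => x y; rewrite -rmorphB norm_conjC.
- by move=> M; exact: (cvgD (hf M) (hg M)).
- by move=> M; exact: (cvgM (hf M) (hg M)).
by rewrite -(funext fg).
Qed.

Lemma Re_continuous : continuous (@complex.Re K : (K[i] : numFieldType) -> K).
Proof.
move=> z s /= /nbhs_ballP[e /= e0 es]; apply/nbhs_ballP; exists e%:C => /=.
  by rewrite ltcR.
move=> y; rewrite /ball /= => zy; apply: es; rewrite /ball /=.
rewrite -ltcR; apply: le_lt_trans zy; rewrite -raddfB.
exact: normc_ge_Re.
Qed.

Lemma star_poly_Re_borel (f : 'M[K[i]]_d -> K[i]) (B : set K) :
  star_poly f -> measurable B -> borel_mx ((fun M => complex.Re (f M)) @^-1` B).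
Proof.
move=> hf; set g := fun M => _.
have cg : continuous (g : 'M[K[i] : numFieldType]_d -> K).
  by move=> M; exact: (continuous_comp (@star_poly_continuous _ hf M) (@Re_continuous (f M))).
(* Open intervals generate the Borel sets of [K], and the sets with a preimage in [borel_mx] form a
   sigma-algebra, so open intervals suffice. *)
move=> mB; have : (<<s @RGenOpens.G K>>) B.
  by rewrite -[X in X B](RGenOpens.measurableE K).
move: B {mB}; apply: smallest_sub.
  have := @sigma_algebra_image _ _ setT g (@borel_mx K d).
  rewrite /image_set_system; under eq_fun do rewrite setTI; apply.
  exact: smallest_sigma_algebra.
move=> _ [x [y ->]]; apply: sub_sigma_algebra; apply: open_comp; last exact: interval_open.
by move=> M _; apply: cg.
Qed.

Lemma unitary_entry_le1 (U : 'M[K[i]]_d) i j : U \is unitarymx -> `|U i j| <= 1.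
Proof.
move=> /unitarymxP /matrixP /(_ i i); rewrite !mxE eqxx => e.
rewrite -(@expr_le1 _ 2) // normCK -[leRHS]e (bigD1 j) //= !mxE lerDl.
by apply: sumr_ge0 => k _; rewrite !mxE mul_conjC_ge0.
Qed.

Lemma star_poly_bounded (f : 'M[K[i]]_d -> K[i]) : star_poly f ->
  exists2 m : K, 0 <= m & forall U, U \is unitarymx -> `|f U| <= m%:C.
Proof.
elim=> {f} [c|i j|f _ [m m0 h]|f g _ [m m0 h] _ [m' m'0 h']|f g _ [m m0 h] _ [m' m'0 h']
  |f g fg _ [m m0 h]].
- exists (complex.Re `|c|) => [|U _]; last by rewrite RRe_real ?normr_real.
  by rewrite -lecR RRe_real ?normr_real // normr_ge0.
- by exists 1 => // U /unitary_entry_le1.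
- by exists m => // U /h; rewrite norm_conjC.
- exists (m + m') => [|U Uu]; first exact: addr_ge0.
  by rewrite rmorphD (le_trans (ler_normD _ _)) // lerD ?h ?h'.
- exists (m * m') => [|U Uu]; first exact: mulr_ge0.
  by rewrite rmorphM normrM ler_pM ?h ?h'.
by exists m => // U /h; rewrite fg.
Qed.

Lemma star_poly_left (U : 'M[K[i]]_d) (f : 'M[K[i]]_d -> K[i]) :
  star_poly f -> star_poly (fun M => f (U *m M)).
Proof.
elim=> {f} [c|i j|f _ hf|f g _ hf _ hg|f g _ hf _ hg|f g fg _ hf].
- exact: star_poly_cst.
- exact: star_poly_mulmx.
- exact: star_poly_conj.
- exact: star_poly_add.
- exact: star_poly_mul.
by apply: eq_star_poly hf => M; apply: fg.
Qed.

End HaarExpectation.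

Lemma eq_expectation_law (K : realType) (disp : measure_display)
    (T : measurableType disp) (P : probability T K) (X Y : {mfun T >-> K}) :
  (X : T -> K) \in Lfun P 1 -> (Y : T -> K) \in Lfun P 1 ->
  (forall B, measurable B -> P (X @^-1` B) = P (Y @^-1` B)) ->
  ('E_P[X] = 'E_P[Y])%E.
Proof.
move=> /Lfun1_integrable iX /Lfun1_integrable iY XY; rewrite unlock.
have mE : measurable_fun setT (@EFin K) by apply/measurable_EFinP.
rewrite -(@integral_distribution _ _ _ _ _ P X _ mE iX).
rewrite -(@integral_distribution _ _ _ _ _ P Y _ mE iY).
by apply: eq_measure_integral => B mB _; apply: XY.
Qed.

(** The imaginary part of a mean is the real part of the mean of [- 'i * f], so measure theory is
    applied only to real parts of star polynomials. *)
Lemma Re_mulNi (K : rcfType) (z : K[i]) : complex.Re (- 'i * z) = complex.Im z.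
Proof. by rewrite -complexiE; case: z => a b; simpc. Qed.

(** * Linearity and left invariance of the Haar mean *)

Section Haar.
Variables (K : realType) (d : nat) (disp : measure_display).
Variables (T : measurableType disp) (P : probability T K) (Psi : T -> 'M[K[i]]_d).
Hypothesis haarPsi : haar_unitary P Psi.
Implicit Types f g : 'M[K[i]]_d -> K[i].

Lemma measurable_star_poly_Re f : star_poly f ->
  measurable_fun setT (fun w => complex.Re (f (Psi w))).
Proof.
have [_ Pm _] := haarPsi => hf _ B mB; rewrite setTI.
exact: (Pm _ (star_poly_Re_borel hf mB)).
Qed.

Lemma Lfun_star_poly_Re f : star_poly f ->
  (fun w => complex.Re (f (Psi w))) \in Lfun P 1.
Proof.
move=> hf; have [Pu _ _] := haarPsi; have [m m0 hm] := star_poly_bounded hf.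
apply/Lfun1_integrable; apply: measurable_bounded_integrable => //.
- by rewrite (le_lt_trans (probability_le1 P measurableT)) ?ltry.
- exact: measurable_star_poly_Re.
exists m; split; first exact: num_real.
move=> x mx w _ /=; rewrite (le_trans _ (ltW mx)) // -lecR.
by rewrite (le_trans (normc_ge_Re _)) ?hm.
Qed.

Lemma expectation_left (U : 'M[K[i]]_d) f : U \is unitarymx -> star_poly f ->
  ('E_P[fun w => complex.Re (f (U *m Psi w))] = 'E_P[fun w => complex.Re (f (Psi w))])%E.
Proof.
move=> Uu hf; have [_ _ Pinv] := haarPsi.
have hfU := star_poly_left U hf.
pose X : {mfun T >-> K} := HB.pack (fun w => complex.Re (f (U *m Psi w)))
  (isMeasurableFun.Build _ _ _ _ _ (measurable_star_poly_Re hfU)).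
pose Y : {mfun T >-> K} := HB.pack (fun w => complex.Re (f (Psi w)))
  (isMeasurableFun.Build _ _ _ _ _ (measurable_star_poly_Re hf)).
apply: (@eq_expectation_law _ _ _ P X Y); [exact: Lfun_star_poly_Re hfU|exact: Lfun_star_poly_Re|].
by move=> B mB; exact: (Pinv U _ Uu (star_poly_Re_borel hf mB)).
Qed.

Definition haar_mean f : K[i] := cexpectation P (fun w => f (Psi w)).

Let mean f : K := fine ('E_P[fun w => complex.Re (f (Psi w))])%E.

Let haar_meanE f : haar_mean f = (mean f) +i* (mean (fun M => - 'i * f M)).
Proof.
rewrite /haar_mean /cexpectation; congr (_ +i* fine _)%C.
congr (expectation _ _); apply/funext => w.
by rewrite Re_mulNi.
Qed.

Let meanD f g : star_poly f -> star_poly g ->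
  mean (fun M => f M + g M) = mean f + mean g.
Proof.
move=> hf hg; rewrite /mean -fineD ?expectation_fin_num ?Lfun_star_poly_Re //.
rewrite -expectationD ?Lfun_star_poly_Re //; congr (fine (expectation _ _)).
by apply/funext => w /=; rewrite raddfD.
Qed.

Let meanZ (a : K) f : star_poly f -> mean (fun M => a%:C * f M) = a * mean f.
Proof.
move=> hf; rewrite /mean.
have -> : (fun w => complex.Re (a%:C * f (Psi w))) =
    (a \o* (fun w => complex.Re (f (Psi w)))).
  apply/funext => w /=; case: (f _) => x y /=; rewrite mul0r subr0; by rewrite mulrC.
rewrite expectationZl ?Lfun_star_poly_Re // fineM ?expectation_fin_num ?Lfun_star_poly_Re //.
Qed.

Lemma haar_mean_cst (c : K[i]) : haar_mean (fun=> c) = c.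
Proof.
have mc a : mean (fun=> a) = complex.Re a by rewrite /mean expectation_cst.
by rewrite haar_meanE !mc Re_mulNi; case: c.
Qed.

Lemma eq_haar_mean f g : (forall M, M \is unitarymx -> f M = g M) ->
  haar_mean f = haar_mean g.
Proof.
have [Pu _ _] := haarPsi; move=> fg; rewrite /haar_mean; congr cexpectation.
by apply/funext => w; apply: fg.
Qed.

Lemma haar_meanD f g : star_poly f -> star_poly g ->
  haar_mean (fun M => f M + g M) = haar_mean f + haar_mean g.
Proof.
move=> hf hg; have hi h : star_poly h -> star_poly (fun M => - 'i * h M).
  by move=> hh; apply: star_poly_mul => //; apply: star_poly_cst.
rewrite !haar_meanE meanD // [mean (fun M => _ * (_ + _))](_ : _ =
  mean (fun M => - 'i * f M + - 'i * g M)); last first.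
  by congr mean; apply/funext => M; rewrite mulrDr.
by rewrite meanD; [simpc|exact: hi|exact: hi].
Qed.

Lemma haar_meanZ c f : star_poly f -> haar_mean (fun M => c * f M) = c * haar_mean f.
Proof.
have hi h : star_poly h -> star_poly (fun M => - 'i * h M).
  by move=> hh; apply: star_poly_mul => //; apply: star_poly_cst.
have hr (a : K) h : star_poly h -> star_poly (fun M => a%:C * h M).
  by move=> hh; apply: star_poly_mul => //; apply: star_poly_cst.
have realZ (a : K) h : star_poly h -> haar_mean (fun M => a%:C * h M) = a%:C * haar_mean h.
  move=> hh; rewrite !haar_meanE meanZ // [mean (fun M => _ * (_ * _))](_ : _ =
    mean (fun M => a%:C * (- 'i * h M))); last first.
    by congr mean; apply/funext => M; rewrite mulrCA.
  by rewrite meanZ; [simpc|exact: hi].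
have imZ h : star_poly h -> haar_mean (fun M => - 'i * h M) = - 'i * haar_mean h.
  move=> hh; rewrite !haar_meanE [mean (fun M => _ * (_ * _))](_ : _ =
    mean (fun M => (- 1)%:C * h M)); last first.
    congr mean; apply/funext => M; rewrite mulrA mulrNN -expr2 sqrCi.
    by rewrite rmorphN1.
  by rewrite meanZ // -complexiE; simpc.
(* Compatibility with real scalars and with [- 'i] is enough, since these generate the complex
   scalars. *)
move=> hf; have -> : c = (complex.Re c)%:C + (- complex.Im c)%:C * - 'i.
  by rewrite -complexiE; case: c => a b; simpc.
rewrite mulrDl -mulrA -imZ // -realZ // -realZ; last exact: hi.
rewrite -haar_meanD; [|exact: hr|by apply: hr; apply: hi].
by apply: eq_haar_mean => M _; rewrite mulrDl -mulrA.
Qed.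

Lemma haar_mean_left (U : 'M[K[i]]_d) f : U \is unitarymx -> star_poly f ->
  haar_mean (fun M => f (U *m M)) = haar_mean f.
Proof.
move=> Uu hf; rewrite !haar_meanE /mean (expectation_left Uu hf).
have hi : star_poly (fun M => - 'i * f M).
  by apply: star_poly_mul => //; apply: star_poly_cst.
by rewrite (expectation_left Uu hi).
Qed.

End Haar.

(** * Expansion of the atoms *)

(** On the full set [gram] is [d] to the number of cycles. The function [wg] shows that the set in
    the definition of [Wg] is inhabited, so [get] returns an inverse, and inverses are unique. *)
Lemma WgE (K : realType) (q d : nat) : wg_defined K 'I_q d ->
  Wg K d = wg K [set: 'I_q]%SET d :> ('S_q -> K).
Proof.
move=> hd; have [d0 /(_ [set: 'I_q]%SET) inv] := hd.
have dn0 : d%:R != 0 :> K by rewrite pnatr_eq0 -lt0n.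
have gramE (s : 'S_q) : gram K [set: 'I_q]%SET d s = d%:R ^+ #|porbits s|.
  rewrite /gram (_ : perm_on _ _); last by apply/fintype.subsetP => x _; rewrite inE.
  by rewrite cardsT -(perm_lenK s) addnC exprD mulfK // expf_neq0.
rewrite /Wg; set S := [set f | _].
have [] : S (get S).
  apply: (@getPex _ S); exists (wg K [set: 'I_q]%SET d); split; apply/funext => s.
    by rewrite -[RHS]inv; apply: eq_bigr => t _; rewrite gramE.
  by rewrite -[RHS](gconvC inv); apply: eq_bigr => t _; rewrite gramE.
move=> e _; apply/funext => s; apply: (gconv_uniq _ inv) => {}s.
transitivity (convolution_unit K s) => //; rewrite -e.
by apply: eq_bigr => t _; rewrite gramE.
Qed.

Definition atoms (L R : nat) (B : {set 'I_L}) : {set 'I_(L + R)} :=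
  (@lshift L R @: B)%SET.

Section AtomExpansion.
Variables (K : realType) (L R : nat).
Let q := (L + R)%N.

Lemma atom_circuits_fixes (s t : 'S_q) : fixes (atom_circuits s t) (permdiv s t).
Proof.
move=> x /imsetP[l]; rewrite inE => /andP[/eqP sl /eqP tl] ->.
by rewrite /permdiv permM -{1}tl permK sl.
Qed.

(** Turns a sum over pairs of permutations of the complement of [B] into a sum over pairs on all
    positions, so that the sums over [B] and over pairs can be exchanged. *)
Lemma perm_on_atoms (B : {set 'I_L}) (s t : 'S_q) :
  perm_on (~: atoms R B)%SET s && perm_on (~: atoms R B)%SET t =
  (atoms R B \subset atom_circuits s t).
Proof.
apply/andP/fintype.subsetP => [[hs ht] x /imsetP[l lB ->]|h].
  have lA : lshift R l \notin (~: atoms R B)%SET by rewrite inE negbK imset_f.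
  by apply: imset_f; rewrite inE (out_perm hs) // (out_perm ht) // eqxx.
split; apply/fintype.subsetP => x; rewrite !inE; apply: contra => /h /imsetP[l];
  by rewrite inE => /andP[sl tl] ->.
Qed.

Lemma centered_wg_atoms (s t : 'S_q) d :
  centered_wg K (atom_circuits s t) d (permdiv s t) =
  \sum_(B : {set 'I_L} | atoms R B \subset atom_circuits s t)
    (- d%:R^-1) ^+ #|B| * wg K (~: atoms R B)%SET d (permdiv s t).
Proof.
have inj : injective (@lshift L R) by apply: lshift_inj.
rewrite /centered_wg (reindex_onto (@atoms L R) (fun X => @lshift L R @^-1: X)%SET) /=.
  apply: eq_big => [B|B _]; last by rewrite card_imset.
  rewrite andb_idr // => _; apply/eqP/setP => l; rewrite inE.
  by rewrite mem_imset.
move=> X XA; apply/setP => x; apply/imsetP/idP => [[l]|xX].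
  by rewrite inE => lX ->.
have /imsetP[l _ xl] := fintype.subsetP XA _ xX.
by exists l; rewrite ?inE -?xl.
Qed.

End AtomExpansion.

(** * The expectation as a sum of centered Weingarten sums over covering pairs *)

Section Expansion.
Variables (K : realType) (L R d : nat).
Let q := (L + R)%N.
Variables (disp : measure_display) (T : measurableType disp).
Variables (P : probability T K) (Psi : T -> 'M[K[i]]_d).
Hypothesis haarPsi : haar_unitary P Psi.
Hypotheses (qd : (q <= d)%N) (hd : wg_defined K 'I_q d).
Variables (a b : 'I_L -> 'I_d) (j k j' k' : 'I_R -> 'I_d).
Let CP := covering_pairs (fcat a j) (fcat b k) (fcat a j') (fcat b k').

Lemma moment_wg (D : {set 'I_q}) (x y x' y' : 'I_q -> 'I_d) :
  moment (haar_mean P Psi) D y y' x x' =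
  \sum_(st : 'S_q * 'S_q | perm_on D st.1 && perm_on D st.2)
    ([forall l in D, (x l == x' (st.2 l)) && (y l == y' (st.1 l))]%:R *
     wg K D d (permdiv st.1 st.2))%:C.
Proof.
have [d0 inv] := hd.
have gW : gconv (fun s => if perm_on D s then d%:R ^+ #|D| / d%:R ^+ perm_len s else 0)
    (fun s => (wg K D d s)%:C) =1 @gdelta K[i] _.
  move=> s; rewrite -(_ : (gdelta K s)%:C = gdelta K[i] s); last by rewrite rmorph_nat.
  rewrite -(gconvC (inv D)) rmorph_sum; apply: eq_bigr => t _.
  rewrite /gram; case: ifP => _; last by rewrite !mul0r rmorph0.
  by move: (wg _ _ _ _) => v; rewrite !rmorphM fmorphV !rmorphXn !rmorph_nat.
(* Since [q <= d], the [q] positions embed as distinct matrix indices. *)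
have wi : injective (widen_ord qd) by move=> u v /(congr1 val) /= /val_inj.
rewrite (weingarten_formula (haar_mean_cst P Psi) (haar_meanD haarPsi)
  (haar_meanZ haarPsi) (haar_mean_left haarPsi) (eq_haar_mean haarPsi) _ _ wi _ _ d0 gW).
rewrite exchange_big /= pair_big /=; apply: eq_bigr => -[s t] _ /=.
(* The Weingarten formula produces [s^-1 * t], the inverse of [permdiv s t]; [wg] takes the same
   value at both. *)
have -> : permdiv s t = (s^-1 * t)^-1%g by rewrite /permdiv invMg invgK.
rewrite (wgV hd); move: (wg _ _ _ _) => v.
rewrite [RHS]rmorphM rmorph_nat -natrM mulnb; congr ((nat_of_bool _)%:R * _).
  apply/andP/forall_inP => [[/forall_inP h /forall_inP h'] l lD|h].
    by rewrite h ?h'.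
by split; apply/forall_inP => l /h /andP[].
Qed.

Let fcat_l (X : Type) (f : 'I_L -> X) (g : 'I_R -> X) l : fcat f g (lshift R l) = f l.
Proof. by rewrite /fcat -[lshift R l]/(unsplit (inl l)) unsplitK. Qed.

Let fcat_r (X : Type) (f : 'I_L -> X) (g : 'I_R -> X) r : fcat f g (rshift L r) = g r.
Proof. by rewrite /fcat -[rshift L r]/(unsplit (inr r)) unsplitK. Qed.

(** On the atoms in [B] both permutations are the identity, and an entry and its conjugate carry the
    same labels, so the matching conditions hold there automatically. *)
Lemma covering_pairs_atoms (B : {set 'I_L}) (s t : 'S_q) :
  atoms R B \subset atom_circuits s t ->
  [forall l in (~: atoms R B)%SET, (fcat a j l == fcat a j' (t l)) &&
     (fcat b k l == fcat b k' (s l))] = ((s, t) \in CP).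
Proof.
move=> /fintype.subsetP BA; rewrite inE; apply/forall_inP/forallP => [h l|h l _]; last exact: h.
have [/imsetP[m mB lm]|lB] := boolP (l \in atoms R B); last by apply: h; rewrite inE.
have /imsetP[m'] := BA _ (imset_f _ mB); rewrite inE => /andP[/eqP sl /eqP tl] e.
rewrite -[(s, t).1]/s -[(s, t).2]/t lm; rewrite -e in sl tl *.
by rewrite sl tl !fcat_l !eqxx.
Qed.

Lemma atom_product (M : 'M[K[i]]_d) (B : {set 'I_L}) :
  (\prod_(l < L) (if l \in B then - d%:R^-1 else `|M (a l) (b l)| ^+ 2)) *
    \prod_(r < R) (M (j r) (k r) * (M (j' r) (k' r))^*%R) =
  (- d%:R^-1) ^+ #|B| * \prod_(i in (~: atoms R B)%SET)
    (M (fcat a j i) (fcat b k i) * (M (fcat a j' i) (fcat b k' i))^*%R).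
Proof.
have inj : injective (@lshift L R) by apply: lshift_inj.
rewrite big_split_ord /= mulrA; congr (_ * _); last first.
  apply: eq_big => [r|r _]; last by rewrite !fcat_r.
  by rewrite inE; apply/esym/imsetP => -[l _ /eqP]; rewrite eq_rlshift.
rewrite (bigID (mem B)) /=; congr (_ * _).
  by rewrite (eq_bigr (fun=> - d%:R^-1)) ?prodr_const // => l ->.
apply: eq_big => [l|l /negPf ->]; first by rewrite inE mem_imset.
by rewrite !fcat_l normCK.
Qed.

(** Expand the product over the atoms, with [B] the set of those contributing [-1/d]. The Weingarten
    formula on the complement of [B] gives a sum over covering pairs that fix [B], and exchanging
    the sums leaves for each pair the alternating sum [centered_wg]. *)
Lemma haar_mean_expansion :
  haar_mean P Psi (fun M =>
    \prod_(l < L) (`|M (a l) (b l)| ^+ 2 - d%:R^-1) *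
    \prod_(r < R) (M (j r) (k r) * (M (j' r) (k' r))^*%R)) =
  (\sum_(st in CP) centered_wg K (atom_circuits st.1 st.2) d (permdiv st.1 st.2))%:C.
Proof.
pose z (B : {set 'I_L}) (M : 'M[K[i]]_d) := \prod_(i in (~: atoms R B)%SET)
  (M (fcat a j i) (fcat b k i) * (M (fcat a j' i) (fcat b k' i))^*%R).
have zp B : star_poly (z B).
  apply: star_poly_prod => i _; apply: star_poly_mul; first exact: star_poly_entry.
  exact/star_poly_conj/star_poly_entry.
transitivity (haar_mean P Psi (fun M =>
    \sum_(B : {set 'I_L}) (- d%:R^-1) ^+ #|B| * z B M)).
  apply: (eq_haar_mean haarPsi) => M _.
  under eq_bigr do rewrite addrC.
  rewrite bigA_distr mulr_suml; apply: eq_bigr => B _; exact: atom_product.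
rewrite (E_sum (haar_mean_cst P Psi) (haar_meanD haarPsi) (eq_haar_mean haarPsi)); last first.
  by move=> B _; apply: star_poly_mul => //; apply: star_poly_cst.
transitivity ((\sum_(B : {set 'I_L}) \sum_(st : 'S_q * 'S_q |
    (st \in CP) && (atoms R B \subset atom_circuits st.1 st.2))
      (- d%:R^-1) ^+ #|B| * wg K (~: atoms R B)%SET d (permdiv st.1 st.2))%:C); last first.
  rewrite (exchange_big_dep (mem CP)) /=; last by move=> B st _ /andP[].
  congr (_%:C); apply: eq_bigr => -[s t] stCP; rewrite centered_wg_atoms.
  by apply: eq_bigl => B; rewrite stCP.
rewrite rmorph_sum; apply: eq_bigr => B _.
rewrite (haar_meanZ haarPsi) // -[haar_mean _ _ _]/(moment _ _ _ _ _ _) moment_wg.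
rewrite -rmorph_sum (_ : - d%:R^-1 = (- d%:R^-1)%:C); last first.
  by rewrite rmorphN fmorphV rmorph_nat.
rewrite -rmorphXn -rmorphM; congr (_%:C); rewrite mulr_sumr.
rewrite [RHS]big_mkcondl [LHS]big_mkcond [RHS]big_mkcond; apply: eq_bigr => -[s t] _ /=.
rewrite perm_on_atoms; case: ifP => // BA; rewrite covering_pairs_atoms //.
by case: ifP => _; rewrite ?mul1r // mul0r mulr0.
Qed.

End Expansion.

(** [C] and [d0] precede [d], the law and the indices, so the bound is uniform in them; [eps] holds
    the separate relative error of each covering pair. *)
Theorem theorem3p6 (K : realType) (L R : nat) :
  exists (C : K) (d0 : nat),
  forall (d : nat), (d0 <= d)%N -> (L + R <= d)%N ->
  forall (disp : measure_display) (T : measurableType disp)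
    (P : probability T K) (Psi : T -> 'M[K[i]]_d), haar_unitary P Psi ->
  forall (a b : 'I_L -> 'I_d) (j k j' k' : 'I_R -> 'I_d),
  let CP := covering_pairs (fcat a j) (fcat b k) (fcat a j') (fcat b k') in
  exists eps : 'S_(L + R) -> 'S_(L + R) -> K,
    (forall s t, (s, t) \in CP -> `|eps s t| <= C / d%:R) /\
    cexpectation P (fun w =>
      \prod_(l < L) (`|Psi w (a l) (b l)| ^+ 2 - d%:R^-1) *
      \prod_(r < R) (Psi w (j r) (k r) * Num.conj (Psi w (j' r) (k' r)))) =
    (\sum_(st in CP)
       let A := atom_circuits st.1 st.2 in
       d%:R ^- (2 * (#|A|.+1)./2) *
       rho K A (permdiv st.1 st.2) *
       Wg K d (permdiv st.1 st.2) * (1 + eps st.1 st.2))%:C.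
Proof.
have [C [d0 rel]] := centered_wg_relative K (L + R).
have [d1 def] := wg_defined_eventually K 'I_(L + R).
exists C, (maxn d0 d1) => d; rewrite geq_max => /andP[/rel {}rel /def hd] qd.
move=> disp T P Psi haarPsi a b j k j' k' CP.
(* The error terms exist for each pair separately and are collected into one function by choice. *)
have /choice[eps heps] (st : 'S_(L + R) * 'S_(L + R)) : exists e : K,
    `|e| <= C / d%:R /\ centered_wg K (atom_circuits st.1 st.2) d (permdiv st.1 st.2) =
      d%:R ^- (2 * (#|atom_circuits st.1 st.2|.+1)./2) *
      rho K (atom_circuits st.1 st.2) (permdiv st.1 st.2) *
      wg K [set: 'I_(L + R)]%SET d (permdiv st.1 st.2) * (1 + e).
  by have [e he eq] := rel _ _ (@atom_circuits_fixes L R st.1 st.2); exists e.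
exists (fun s t => eps (s, t)); split=> [s t _|]; first by have [] := heps (s, t).
transitivity (haar_mean P Psi (fun M =>
    \prod_(l < L) (`|M (a l) (b l)| ^+ 2 - d%:R^-1) *
    \prod_(r < R) (M (j r) (k r) * (M (j' r) (k' r))^*%R))) => //.
rewrite (haar_mean_expansion haarPsi qd hd); congr (_%:C).
apply: eq_bigr => -[s t] _; have [_ ->] := heps (s, t).
by rewrite (WgE hd).
Qed.
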